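(* Let $\mathcal A$ be a partially abelian exact category. Let $X\hookrightarrow Y\twoheadrightarrow Z$ be an admissible short exact sequence of $\underleftrightarrow{\lim}\,\mathcal A$, and let $[U\hookrightarrow Y]\in\Gamma(Y)$ be given. Then there is a commutative diagram $$\begin{array}{ccccc} U\cap X & \hookrightarrow & U & \twoheadrightarrow & \dfrac{U}{U\cap X}\\ \downarrow & & \downarrow & & \downarrow {\scriptstyle m}\\ X & \hookrightarrow & Y & \twoheadrightarrow & Z \end{array}$$ whose vertical arrows are monomorphisms, $U\cap X$ denoting the pullback of $X\hookrightarrow Y\hookleftarrow U$, in which the top row is an admissible short exact sequence of $\mathrm{Pro}^a(\mathcal A)$, and such that the arrow $m\colon \dfrac{U}{U\cap X}\hookrightarrow Z$ is an admissible monomorphism and $\left[\dfrac{U}{U\cap X}\hookrightarrow Z\right]$ is in $\Gamma(Z)$.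
   Context: Exact categories are in the sense of Quillen, with admissible short exact sequences $a'\hookrightarrow a\twoheadrightarrow a''$, admissible monomorphisms $\hookrightarrow$ and admissible epimorphisms $\twoheadrightarrow$. An exact category is partially abelian exact if every arrow which is the composition of an admissible monomorphism followed by an admissible epimorphism can be factored in a unique way (up to isomorphism) as an admissible epimorphism followed by an admissible monomorphism. For an exact category $\mathcal A$, $\mathrm{Pro}^a(\mathcal A)$ (resp. $\mathrm{Ind}^a(\mathcal A)$) is the full subcategory of $\mathrm{Pro}(\mathcal A)$ (resp. $\mathrm{Ind}(\mathcal A)$) of formal limits (resp. colimits) of countable systems whose structure morphisms are admissible epimorphisms (resp. admissible monomorphisms). These are exact categories: admissible short exact sequences are those isomorphic to the formal limit (resp. colimit) of a system of admissible short exact sequences of $\mathcal A$. The Beilinson category $\underleftrightarrow{\lim}\,\mathcal A$ is the full subcategory of $\mathrm{Ind}^a\mathrm{Pro}^a(\mathcal A)$ of objects $``\varinjlim_j''\,``\varprojlim_i''\,X_{i,j}$, $(i,j)\in\mathbb Z\times\mathbb Z$, $i\le j$, with admissible monomorphisms $X_{i,j}\hookrightarrow X_{i,j'}$ and admissible epimorphisms $X_{i,j}\twoheadrightarrow X_{i',j}$ ($i\le i'\le j\le j'$; formal limit over $i\to-\infty$, formal colimit over $j\to+\infty$), such that all the squares formed by $X_{i,j},X_{i,j'},X_{i',j},X_{i',j'}$ are cartesian (hence cocartesian). Its admissible short exact sequences are those of $\mathrm{Ind}^a(\mathrm{Pro}^a(\mathcal A))$ with all terms in $\underleftrightarrow{\lim}\,\mathcal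 A$. The categories $\mathcal A$, $\mathrm{Pro}^a(\mathcal A)$, $\mathrm{Ind}^a(\mathcal A)$ are regarded as full subcategories of $\underleftrightarrow{\lim}\,\mathcal A$. An admissible subobject $[V\hookrightarrow X]$ is an admissible monomorphism up to isomorphism over $X$. The Sato Grassmannian $\Gamma(X)$ of $X\in\underleftrightarrow{\lim}\,\mathcal A$ is the set of admissible subobjects $[V\hookrightarrow X]$ such that $V\in\mathrm{Pro}^a(\mathcal A)$ and $X/V\in\mathrm{Ind}^a(\mathcal A)$. *)

(* Defs.v *)
From mathcomp Require Import all_boot all_order all_algebra.
From Stdlib Require Import Setoid Morphisms.

Set Implicit Arguments.
Unset Strict Implicit.
Unset Printing Implicit Defensive.

Import Order.TTheory GRing.Theory Num.Theory.

Declare Scope cat_scope.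
Delimit Scope cat_scope with cat.
Local Open Scope cat_scope.

(** * Categories *)

(* Equality of arrows is an equivalence relation [heq], so that the filtered
   colimits of sets in the definition of Ind(C) need no quotient types.  An
   ordinary category is the case where [heq] is Leibniz equality. *)
Record category := Category {
  ob :> Type;
  hom : ob -> ob -> Type;
  heq : forall a b, hom a b -> hom a b -> Prop;
  idm : forall a, hom a a;
  comp : forall a b c, hom b c -> hom a b -> hom a c;
  heq_equiv : forall a b, Equivalence (@heq a b);
  comp_heq : forall a b c (g g' : hom b c) (f f' : hom a b),
    heq g g' -> heq f f' -> heq (comp g f) (comp g' f');
  comp1m : forall a b (f : hom a b), heq (comp (idm b) f) f;
  compm1 : forall a b (f : hom a b), heq (comp f (idm a)) f;
  compA : forall a b c d (h : hom c d) (g : hom b c) (f : hom a b),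
    heq (comp h (comp g f)) (comp (comp h g) f) }.

Arguments hom {c} _ _ : rename.
Arguments heq {c a b} _ _ : rename.
Arguments idm {c} a : rename.
Arguments comp {c a b c0} _ _ : rename.

Notation "f =~ g" := (heq f g) (at level 70, no associativity) : cat_scope.
Notation "g \oc f" := (comp g f) (at level 50, left associativity,
  format "g  \oc  f") : cat_scope.

#[export] Existing Instance heq_equiv.
#[export] Instance comp_proper (C : category) (a b c : C) :
  Proper (heq ==> heq ==> heq) (@comp C a b c).
Proof. by move=> g g' eg f f' ef; apply: comp_heq. Qed.

Definition op (C : category) : category.
Proof.
refine (@Category C (fun a b => @hom C b a) (fun a b f g => f =~ g)
  (fun a => idm a) (fun a b c g f => f \oc g)
  (fun a b => @heq_equiv C b a) _ _ _ _).
- by move=> a b c g g' f f' eg ef; apply: comp_heq.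
- by move=> a b f; exact: compm1.
- by move=> a b f; exact: comp1m.
- by move=> a b c d h g f; symmetry; exact: compA.
Defined.

Definition full_sub (C : category) (P : C -> Prop) : category.
Proof.
refine (@Category {x : C | P x} (fun a b => hom (sval a) (sval b))
  (fun a b f g => f =~ g) (fun a => idm (sval a)) (fun a b c g f => g \oc f)
  (fun a b => @heq_equiv C (sval a) (sval b)) _ _ _ _).
- by move=> a b c g g' f f'; exact: comp_heq.
- by move=> a b f; exact: comp1m.
- by move=> a b f; exact: compm1.
- by move=> a b c d h g f; exact: compA.
Defined.

Section CategoryNotions.
Variable C : category.

Definition mono (a b : C) (f : hom a b) : Prop :=
  forall t (h k : hom t a), f \oc h =~ f \oc k -> h =~ k.

Definition is_iso (a b : C) (f : hom a b) : Prop :=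
  exists g : hom b a, g \oc f =~ idm a /\ f \oc g =~ idm b.

Definition isomorphic (a b : C) : Prop := exists f : hom a b, is_iso f.

Definition exists_unique_hom (a b : C) (P : hom a b -> Prop) : Prop :=
  exists h, P h /\ forall h', P h' -> h' =~ h.

(* The square   d --q--> b
                |p       |g
                a --f--> c   is cartesian. *)
Definition is_pullback (a b c d : C) (f : hom a c) (g : hom b c)
    (p : hom d a) (q : hom d b) : Prop :=
  f \oc p =~ g \oc q /\
  forall t (h : hom t a) (k : hom t b), f \oc h =~ g \oc k ->
    exists_unique_hom (fun u : hom t d => p \oc u =~ h /\ q \oc u =~ k).

(* The square   c --f--> a
                |g       |p
                b --q--> d   is cocartesian. *)
Definition is_pushout (a b c d : C) (f : hom c a) (g : hom c b)
    (p : hom a d) (q : hom b d) : Prop :=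
  p \oc f =~ q \oc g /\
  forall t (h : hom a t) (k : hom b t), h \oc f =~ k \oc g ->
    exists_unique_hom (fun u : hom d t => u \oc p =~ h /\ u \oc q =~ k).

Definition iso_seq (a b c a' b' c' : C) (i : hom a b) (p : hom b c)
    (i' : hom a' b') (p' : hom b' c') : Prop :=
  exists (u : hom a a') (v : hom b b') (w : hom c c'),
    [/\ is_iso u, is_iso v & is_iso w] /\
    v \oc i =~ i' \oc u /\ w \oc p =~ p' \oc v.

(* The subobject [v : V >-> X], as the class of all arrows to X isomorphic to v
   over X. *)
Definition subobj (X V : C) (v : hom V X) : forall V' : C, hom V' X -> Prop :=
  fun V' v' => exists u : hom V' V, is_iso u /\ v \oc u =~ v'.

End CategoryNotions.

(** * Categories with a class of short sequences *)

(* [conf i p] : the sequence a --i--> b --p--> c is admissible short exact. *)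
Record ccat := CCat {
  ccat_cat :> category;
  conf : forall a b c : ccat_cat, hom a b -> hom b c -> Prop }.
Arguments conf {c a b c0} _ _ : rename.

Definition cop (C : ccat) : ccat :=
  @CCat (op C) (fun a b c (i : @hom (op C) a b) (p : @hom (op C) b c) =>
    @conf C c b a p i).

Definition cfull_sub (C : ccat) (P : C -> Prop) : ccat :=
  @CCat (full_sub P) (fun a b c i p => @conf C (sval a) (sval b) (sval c) i p).

Section Admissible.
Variable C : ccat.

Definition adm_mono (a b : C) (i : hom a b) : Prop :=
  exists c (p : hom b c), conf i p.

Definition adm_epi (b c : C) (p : hom b c) : Prop :=
  exists a (i : hom a b), conf i p.

End Admissible.

(** * Exact categories *)

Record additive_structure (C : category) := AdditiveStructure {
  zerom : forall a b : C, hom a b;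
  addm : forall a b : C, hom a b -> hom a b -> hom a b;
  oppm : forall a b : C, hom a b -> hom a b;
  addm_heq : forall (a b : C) (f f' g g' : hom a b),
    f =~ f' -> g =~ g' -> addm f g =~ addm f' g';
  addmA : forall (a b : C) (f g h : hom a b),
    addm f (addm g h) =~ addm (addm f g) h;
  addmC : forall (a b : C) (f g : hom a b), addm f g =~ addm g f;
  add0m : forall (a b : C) (f : hom a b), addm (zerom a b) f =~ f;
  addNm : forall (a b : C) (f : hom a b), addm (oppm f) f =~ zerom a b;
  compDm : forall (a b c : C) (g g' : hom b c) (f : hom a b),
    addm g g' \oc f =~ addm (g \oc f) (g' \oc f);
  compmD : forall (a b c : C) (g : hom b c) (f f' : hom a b),
    g \oc addm f f' =~ addm (g \oc f) (g \oc f');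
  zero_object : exists z : C, idm z =~ zerom z z;
  biproducts : forall a b : C, exists (s : C)
    (i1 : hom a s) (i2 : hom b s) (p1 : hom s a) (p2 : hom s b),
    [/\ p1 \oc i1 =~ idm a, p2 \oc i2 =~ idm b,
        p2 \oc i1 =~ zerom a b, p1 \oc i2 =~ zerom b a
      & addm (i1 \oc p1) (i2 \oc p2) =~ idm s] }.

Section KernelCokernel.
Variables (C : category) (M : additive_structure C).

Definition is_kernel (a b c : C) (i : hom a b) (p : hom b c) : Prop :=
  p \oc i =~ zerom M a c /\
  forall t (h : hom t b), p \oc h =~ zerom M t c ->
    exists_unique_hom (fun k : hom t a => i \oc k =~ h).

Definition is_cokernel (a b c : C) (i : hom a b) (p : hom b c) : Prop :=
  p \oc i =~ zerom M a c /\
  forall t (h : hom b t), h \oc i =~ zerom M a t ->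
    exists_unique_hom (fun k : hom c t => k \oc p =~ h).

End KernelCokernel.

(* Quillen's axioms, in the form given by Keller and Buehler (Quillen's
   "obscure axiom" follows from these). *)
Record exact_category := ExactCategory {
  exact_ccat :> ccat;
  exact_add : additive_structure exact_ccat;
  conf_kernel : forall (a b c : exact_ccat) (i : hom a b) (p : hom b c),
    conf i p -> is_kernel exact_add i p;
  conf_cokernel : forall (a b c : exact_ccat) (i : hom a b) (p : hom b c),
    conf i p -> is_cokernel exact_add i p;
  conf_iso : forall (a b c a' b' c' : exact_ccat) (i : hom a b) (p : hom b c)
    (i' : hom a' b') (p' : hom b' c'),
    iso_seq i p i' p' -> conf i p -> conf i' p';
  adm_mono1 : forall a : exact_ccat, adm_mono (idm a);
  adm_epi1 : forall a : exact_ccat, adm_epi (idm a);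
  adm_mono_comp : forall (a b c : exact_ccat) (i : hom a b) (j : hom b c),
    adm_mono i -> adm_mono j -> adm_mono (j \oc i);
  adm_epi_comp : forall (a b c : exact_ccat) (p : hom a b) (q : hom b c),
    adm_epi p -> adm_epi q -> adm_epi (q \oc p);
  adm_mono_pushout : forall (a b c : exact_ccat) (i : hom c a) (f : hom c b),
    adm_mono i -> exists d (f' : hom a d) (i' : hom b d),
      is_pushout i f f' i' /\ adm_mono i';
  adm_epi_pullback : forall (a b c : exact_ccat) (p : hom a c) (f : hom b c),
    adm_epi p -> exists d (f' : hom d a) (p' : hom d b),
      is_pullback p f f' p' /\ adm_epi p' }.

Definition partially_abelian (A : exact_category) : Prop :=
  forall (a b c : A) (i : hom a b) (p : hom b c), adm_mono i -> adm_epi p ->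
  exists (d : A) (q : hom a d) (j : hom d c),
    [/\ adm_epi q, adm_mono j & p \oc i =~ j \oc q] /\
    forall (d' : A) (q' : hom a d') (j' : hom d' c),
      adm_epi q' -> adm_mono j' -> p \oc i =~ j' \oc q' ->
      exists u : hom d d', [/\ is_iso u, u \oc q =~ q' & j' \oc u =~ j].

(** * Ind- and pro-objects *)

Record preord := Preord {
  pcar :> Set;
  ple : pcar -> pcar -> Prop;
  ple_refl : forall i, ple i i;
  ple_trans : forall i j k, ple i j -> ple j k -> ple i k }.

Definition directed (I : preord) : Prop :=
  inhabited I /\ forall i j : I, exists k, ple i k /\ ple j k.

Definition countable_index (I : preord) : Prop :=
  exists f : I -> nat, injective f.

(* A functor I -> C.  The law [dmapM] (with [dmap1]) makes [dmap] independent
   of the proof of [ple i j]. *)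
Record diagram (C : category) (I : preord) := Diagram {
  dob :> I -> C;
  dmap : forall i j, ple i j -> hom (dob i) (dob j);
  dmap1 : forall i (h : ple i i), dmap h =~ idm (dob i);
  dmapM : forall i j k (h : ple i j) (h' : ple j k) (h'' : ple i k),
    dmap h' \oc dmap h =~ dmap h'' }.
Arguments dmap {C I} d {i j} h.

Lemma dmap_irr (C : category) (I : preord) (D : diagram C I) (i j : I)
  (h h' : ple i j) : dmap D h =~ dmap D h'.
Proof. by rewrite -(dmapM D (ple_refl i) h h') dmap1 compm1; reflexivity. Qed.

Record ind_ob (C : category) := IndOb {
  index : preord;
  index_directed : directed index;
  ind_diag :> diagram C index }.

Section IndHom.
Variable C : category.
Implicit Types (a b : C) (X Y Z : ind_ob C).

(* Representatives of elements of colim_j Hom(a, Y_j), and their equality. *)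
Definition germ a Y : Type := {j : index Y & hom a (Y j)}.

Definition germ_eq a Y (u v : germ a Y) : Prop :=
  exists k (h : ple (tag u) k) (h' : ple (tag v) k),
    dmap Y h \oc tagged u =~ dmap Y h' \oc tagged v.

Definition germ_pre a b Y (u : germ b Y) (f : hom a b) : germ a Y :=
  Tagged (fun j => hom a (Y j)) (tagged u \oc f).

(* Hom(X, Y) = lim_i colim_j Hom(X_i, Y_j). *)
Record ind_hom X Y := IndHom {
  icomp :> forall i : index X, germ (X i) Y;
  icompat : forall i j (h : ple i j),
    germ_eq (icomp i) (germ_pre (icomp j) (dmap X h)) }.

Definition ind_heq X Y (f g : ind_hom X Y) : Prop :=
  forall i, germ_eq (f i) (g i).

Lemma germ_eq_equiv a Y : Equivalence (@germ_eq a Y).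
Proof.
split.
- by move=> [j f]; exists j, (ple_refl j), (ple_refl j); reflexivity.
- by move=> u v [k [h [h' e]]]; exists k, h', h; symmetry.
- move=> u v w [k [h [h' e]]] [l [g [g' e']]].
  have [m [km lm]] := (index_directed Y).2 k l.
  exists m, (ple_trans h km), (ple_trans g' lm).
  rewrite -(dmapM Y h km) -(dmapM Y g' lm) -!compA e -e' !compA.
  by rewrite (dmapM Y h' km (ple_trans h' km)) (dmapM Y g lm (ple_trans h' km));
    reflexivity.
Qed.
#[local] Existing Instance germ_eq_equiv.

Lemma germ_pre_eq a b Y (u v : germ b Y) (f g : hom a b) :
  germ_eq u v -> f =~ g -> germ_eq (germ_pre u f) (germ_pre v g).
Proof.
move=> [k [h [h' e]]] efg; exists k, h, h' => /=.
by rewrite !compA e efg; reflexivity.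
Qed.

Lemma germ_eqE a Y j (f g : hom a (Y j)) : f =~ g ->
  germ_eq (Tagged (fun j => hom a (Y j)) f) (Tagged (fun j => hom a (Y j)) g).
Proof.
by move=> e; exists j, (ple_refl j), (ple_refl j) => /=; rewrite e; reflexivity.
Qed.

Lemma germ_eq_map a Y j k (h : ple j k) (f : hom a (Y j)) :
  germ_eq (Tagged (fun j => hom a (Y j)) f)
          (Tagged (fun j => hom a (Y j)) (dmap Y h \oc f)).
Proof.
by exists k, h, (ple_refl k) => /=; rewrite dmap1 comp1m; reflexivity.
Qed.

(* The map colim_j Hom(a, Y_j) -> colim_k Hom(a, Z_k) induced by Y -> Z. *)
Definition germ_post a Y Z (g : ind_hom Y Z) (u : germ a Y) : germ a Z :=
  germ_pre (g (tag u)) (tagged u).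

Lemma germ_post_eq a Y Z (g g' : ind_hom Y Z) (u v : germ a Y) :
  ind_heq g g' -> germ_eq u v -> germ_eq (germ_post g u) (germ_post g' v).
Proof.
move=> eg [k [h [h' e]]].
have push (w : germ a Y) (hk : ple (tag w) k) :
  germ_eq (germ_post g w) (germ_pre (g k) (dmap Y hk \oc tagged w)).
  rewrite /germ_post.
  transitivity (germ_pre (germ_pre (g k) (dmap Y hk)) (tagged w)).
    by apply: germ_pre_eq; [exact: icompat | reflexivity].
  by apply: germ_eqE => /=; rewrite compA; reflexivity.
transitivity (germ_post g v).
  transitivity (germ_pre (g k) (dmap Y h \oc tagged u)); first exact: push.
  transitivity (germ_pre (g k) (dmap Y h' \oc tagged v)); last first.
    by symmetry; exact: push.
  by apply: germ_pre_eq; first reflexivity.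
by apply: germ_pre_eq; [exact: eg | reflexivity].
Qed.

Definition ind_id X : ind_hom X X.
Proof.
exists (fun i => Tagged (fun j => hom (X i) (X j)) (idm (X i))) => i j h.
exists j, h, (ple_refl j) => /=.
by rewrite dmap1 !comp1m compm1; reflexivity.
Defined.

Definition ind_comp X Y Z (g : ind_hom Y Z) (f : ind_hom X Y) : ind_hom X Z.
Proof.
exists (fun i => germ_post g (f i)) => i j h.
transitivity (germ_post g (germ_pre (f j) (dmap X h))).
  by apply: germ_post_eq; [move=> ?; reflexivity | exact: icompat].
by apply: germ_eqE => /=; rewrite compA; reflexivity.
Defined.

Definition Ind : category.
Proof.
refine (@Category (ind_ob C) ind_hom ind_heq ind_id ind_comp _ _ _ _ _).
- move=> X Y; split.
  + by move=> f i; reflexivity.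
  + by move=> f g e i; symmetry.
  + by move=> f g h e e' i; transitivity (g i).
- by move=> X Y Z g g' f f' eg ef i; apply: germ_post_eq; last exact: ef.
- move=> X Y f i; rewrite /= /germ_post /germ_pre /=.
  by case: (f i) => j u /=; apply: germ_eqE; exact: comp1m.
- move=> X Y f i; rewrite /= /germ_post /germ_pre /=.
  by case: (f i) => j u /=; apply: germ_eqE; exact: compm1.
- move=> X Y Z T h g f i; rewrite /= /germ_post /germ_pre /=.
  by apply: germ_eqE; exact: compA.
Defined.

Definition unit_preord : preord :=
  @Preord unit (fun _ _ => True) (fun _ => I) (fun _ _ _ _ _ => I).

Lemma unit_directed : directed unit_preord.
Proof. by split=> [|[] []]; [exact: (inhabits tt) | exists tt]. Qed.

(* The full embedding C -> Ind(C), on objects and on arrows. *)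
Definition ind_const (a : C) : Ind.
Proof.
refine (IndOb unit_directed
  (@Diagram C unit_preord (fun _ => a) (fun _ _ _ => idm a) _ _)).
- by move=> i h; reflexivity.
- by move=> i j k h h' h''; exact: comp1m.
Defined.

Definition ind_const_hom (a b : C) (f : hom a b) :
  hom (ind_const a) (ind_const b).
Proof.
exists (fun _ => existT (fun j => hom a (ind_const b j)) tt f).
by move=> i j h; apply: germ_eqE; rewrite /= compm1; reflexivity.
Defined.

(* The formal colimit of a natural transformation of diagrams. *)
Definition level_hom (I : preord) (dI : directed I) (S T : diagram C I)
    (f : forall n, hom (S n) (T n))
    (nat_f : forall n m (h : ple n m),
      dmap T h \oc f n =~ f m \oc dmap S h) :
  @hom Ind (IndOb dI S) (IndOb dI T).
Proof.
exists (fun n => Tagged (fun j => hom (S n) (T j)) (f n)) => n m h.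
exists m, h, (ple_refl m) => /=.
by rewrite nat_f dmap1 comp1m; reflexivity.
Defined.

End IndHom.

(** * Ind^a and Pro^a *)

Section Inda.
Variable C : ccat.

Definition inda_ob (X : Ind C) : Prop :=
  countable_index (index X) /\
  forall i j (h : ple i j), adm_mono (dmap (ind_diag X) h).

Definition Inda_cat : category := full_sub inda_ob.

(* X -f-> Y -g-> Z is isomorphic to the formal colimit of a system of
   admissible short exact sequences S_n -> T_n -> R_n whose three component
   systems are objects of Ind^a. *)
Definition inda_conf (X Y Z : Inda_cat) (f : hom X Y) (g : hom Y Z) : Prop :=
  exists (I : preord) (dI : directed I) (S T R : diagram C I)
    (i : forall n, hom (S n) (T n)) (p : forall n, hom (T n) (R n))
    (nat_i : forall n m (h : ple n m), dmap T h \oc i n =~ i m \oc dmap S h)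
    (nat_p : forall n m (h : ple n m), dmap R h \oc p n =~ p m \oc dmap T h),
    [/\ inda_ob (IndOb dI S), inda_ob (IndOb dI T) & inda_ob (IndOb dI R)] /\
    (forall n, conf (i n) (p n)) /\
    @iso_seq (Ind C) _ _ _ _ _ _ f g
      (level_hom dI nat_i) (level_hom dI nat_p).

Definition Inda : ccat := @CCat Inda_cat inda_conf.

End Inda.

(* Pro(C) is the opposite of Ind(C^op), so that Hom(X, Y) is
   lim_j colim_i Hom(X_i, Y_j); admissible epimorphisms of C are the
   admissible monomorphisms of C^op. *)
Definition Proa (C : ccat) : ccat := cop (Inda (cop C)).

(** * The Beilinson category *)

Section Beilinson.
Variable A : exact_category.

(* The pairs (i, j) of integers with i <= j, ordered componentwise.  A diagram
   on it is the same as commuting families X_{i,j} -> X_{i,j'} (j <= j') and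
   X_{i,j} -> X_{i',j} (i <= i' <= j). *)
Definition bpair : preord.
Proof.
refine (@Preord {p : int * int | (p.1 <= p.2)%R}
  (fun p q => (sval p).1 <= (sval q).1 /\ (sval p).2 <= (sval q).2)%R _ _).
- by move=> p; split.
- by move=> p q r [h1 h2] [h3 h4]; split; [exact: le_trans h1 h3|exact: le_trans h2 h4].
Defined.

Definition bfst (p : bpair) : int := (sval p).1.
Definition bsnd (p : bpair) : int := (sval p).2.

Record beilinson_system := BeilinsonSystem {
  bsys :> diagram A bpair;
  bsys_mono : forall p q (h : ple p q), bfst p = bfst q ->
    adm_mono (dmap bsys h);
  bsys_epi : forall p q (h : ple p q), bsnd p = bsnd q ->
    adm_epi (dmap bsys h);
  (* p = (i,j), q = (i,j'), r = (i',j), s = (i',j') *)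
  bsys_cart : forall p q r s (pq : ple p q) (pr : ple p r)
      (qs : ple q s) (rs : ple r s),
    bfst p = bfst q -> bfst r = bfst s -> bsnd p = bsnd r -> bsnd q = bsnd s ->
    is_pullback (dmap bsys qs) (dmap bsys rs) (dmap bsys pq) (dmap bsys pr) }.

(* {i | i <= j} ordered by decreasing i, so that the limit is at -oo. *)
Definition brow (j : int) : preord.
Proof.
refine (@Preord {i : int | (i <= j)%R} (fun i k => (sval k <= sval i)%R) _ _).
- by move=> i; exact: lexx.
- by move=> i k l ik kl; exact: le_trans kl ik.
Defined.

Lemma brow_directed j : directed (brow j).
Proof.
split=> [|[i hi] [k hk]]; first exact: (inhabits (exist _ j (lexx j))).
have h : (Num.min i k <= j)%R by rewrite ge_min hi.
by exists (exist _ (Num.min i k) h) => /=; rewrite !ge_min !lexx orbT.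
Qed.

Lemma brow_countable j : countable_index (brow j).
Proof. by exists (@pickle {i : int | (i <= j)%R}); exact: (pcan_inj pickleK). Qed.

Definition bmk (j : int) (i : brow j) : bpair := exist _ (sval i, j) (svalP i).

(* The pro-object "lim"_i X_{i,j}. *)
Definition brow_pro (X : beilinson_system) (j : int) : Proa A.
Proof.
unshelve refine (exist (@inda_ob (cop A)) (IndOb (brow_directed j)
  (@Diagram (op A) (brow j) (fun i => X (bmk i))
    (fun i k (h : ple i k) => dmap X (_ : ple (bmk k) (bmk i))) _ _)) _).
- by split; [exact: h | exact: lexx].
- by move=> i h; exact: dmap1.
- by move=> i k l h h' h''; exact: dmapM.
- by split=> [|i k h]; [exact: brow_countable | exact: bsys_epi].
Defined.

Lemma bmin_le (i j : int) : (Num.min i j <= j)%R.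
Proof. by rewrite ge_min lexx orbT. Qed.

Definition bmin (j j' : int) (i : brow j') : brow j :=
  exist _ (Num.min (sval i) j) (bmin_le (sval i) j).

Lemma bmin_ple (j j' : int) (hj : (j <= j')%R) (i : brow j') :
  ple (bmk (bmin j i)) (bmk i).
Proof. by split; rewrite /= ?ge_min ?lexx. Qed.

(* For j <= j', the arrow "lim"_i X_{i,j} -> "lim"_i X_{i,j'}; its component at
   i <= j' is X_{min(i,j),j} -> X_{i,j'}. *)
Definition brow_map (X : beilinson_system) (j j' : int) (hj : (j <= j')%R) :
  hom (brow_pro X j) (brow_pro X j').
Proof.
exists (fun i : brow j' =>
  existT (fun k : brow j => @hom A (X (bmk k)) (X (bmk i))) (bmin j i)
    (dmap X (bmin_ple hj i))) => i k h.
exists (bmin j k).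
have h1 : ple (bmin j i) (bmin j k).
  by rewrite /= le_min !ge_min lexx orbT andbT; apply/orP; left.
exists h1, (ple_refl (bmin j k)) => /=.
have h2 : ple (bmk (bmin j k)) (bmk i).
  by apply: ple_trans (bmin_ple hj k) _; split; [exact: h | exact: lexx].
rewrite !(dmapM _ _ _ h2).
by reflexivity.
Defined.

Definition int_preord : preord.
Proof.
refine (@Preord int (fun i j => (i <= j)%R) _ _).
- by move=> i; exact: lexx.
- by move=> i j k; exact: le_trans.
Defined.

Lemma int_directed : directed int_preord.
Proof.
split=> [|i k]; first exact: (inhabits (0%R : int)).
by exists (Num.max i k); rewrite /= !le_max !lexx orbT.
Qed.

(* The double system "colim"_j "lim"_i X_{i,j}, as an object of Ind(Pro^a(A)). *)
Definition beilinson_of (X : beilinson_system) : Ind (Proa A).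
Proof.
refine (IndOb int_directed
  (@Diagram (Proa A) int_preord (brow_pro X) (fun j k => @brow_map X j k) _ _)).
- move=> j hj i; exists (bmin j i).
  have h1 : @ple (brow j) i (bmin j i) by rewrite /= ge_min lexx.
  exists (ple_refl (bmin j i)), h1 => /=.
  by rewrite comp1m (dmapM _ _ _ (bmin_ple hj i)); apply: dmap_irr.
- move=> j k l jk kl jl i; exists (bmin j (bmin k i)).
  have h1 : @ple (brow j) (bmin j i) (bmin j (bmin k i)).
    by rewrite /= le_min !ge_min !lexx !orbT.
  exists (ple_refl (bmin j (bmin k i))), h1 => /=.
  have h2 : ple (bmk (bmin j (bmin k i))) (bmk i).
    by split; rewrite /= ?ge_min ?lexx.
  rewrite !(dmapM _ _ _ h2).
  by reflexivity.
Defined.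

Definition is_beilinson (T : Inda (Proa A)) : Prop :=
  exists X : beilinson_system, @isomorphic (Ind (Proa A)) (sval T) (beilinson_of X).

Definition Beilinson : ccat := cfull_sub is_beilinson.

(* Beilinson objects seen in Ind(Pro^a(A)), where Pro^a(A) and Ind^a(A) are
   also fully embedded. *)
Definition bunder (T : Beilinson) : Ind (Proa A) := sval (sval T).

Definition pro_of (a : A) : Proa A.
Proof.
refine (exist (@inda_ob (cop A)) (@ind_const (op A) a) _).
by split=> [|i j h]; [exists (fun=> 0) => -[] [] | exact: adm_epi1].
Defined.

Definition pro_of_hom (a b : A) (f : hom a b) : hom (pro_of a) (pro_of b) :=
  @ind_const_hom (op A) b a f.

(* Ind^a(A) -> Ind(Pro^a(A)), "colim" Y_j |-> "colim" (pro_of Y_j). *)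
Definition indpro_of (Y : Inda A) : Ind (Proa A).
Proof.
refine (IndOb (index_directed (sval Y))
  (@Diagram (Proa A) (index (sval Y)) (fun j => pro_of (sval Y j))
    (fun j k h => pro_of_hom (dmap (sval Y) h)) _ _)).
- by move=> j h i; apply: (@germ_eqE (op A)); exact: dmap1.
- by move=> j k l h h' h'' i; apply: (@germ_eqE (op A)); exact: dmapM.
Defined.

Definition in_pro (T : Beilinson) : Prop :=
  exists P : Proa A, isomorphic (bunder T) (@ind_const (Proa A) P).

Definition in_ind (T : Beilinson) : Prop :=
  exists Y : Inda A, isomorphic (bunder T) (indpro_of Y).

(* A sequence of Beilinson objects that is an admissible short exact sequence
   of the full subcategory Pro^a(A). *)
Definition pro_conf (R S T : Beilinson) (i : hom R S) (p : hom S T) : Prop :=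
  exists (P Q N : Proa A) (i' : hom P Q) (p' : hom Q N),
    conf i' p' /\
    @iso_seq (Ind (Proa A)) (bunder R) (bunder S) (bunder T) _ _ _ i p
      (@ind_const_hom (Proa A) P Q i') (@ind_const_hom (Proa A) Q N p').

(* The Sato Grassmannian Gamma(X), as a set of subobjects of X. *)
Definition Sato (X : Beilinson) (S : forall V : Beilinson, hom V X -> Prop) :
    Prop :=
  exists (V : Beilinson) (v : hom V X),
    [/\ adm_mono v, in_pro V,
        exists (Q : Beilinson) (p : hom X Q), conf v p /\ in_ind Q
      & forall (V' : Beilinson) (v' : hom V' X), S V' v' <-> subobj v v'].

End Beilinson.

(* Main.v *)
From mathcomp Require Import all_boot order ssralg ssrnum ssrint zify.
Require Import Defs.
From Stdlib Require Import Setoid Morphisms ClassicalEpsilon Classical_Prop.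

(** Why the theorem holds.

    A partially abelian exact category A is abelian, with all short exact
    sequences admissible: every arrow a -> b is its graph a -> a (+) b, an
    admissible monomorphism, followed by the projection to b, an admissible
    epimorphism, hence it has an image ([partially_abelian_abelian]).

    Present the given sequence as the colimit of sequences S_n -> T_n -> R_n
    of Pro^a(A).  The lattice U lies in Pro^a(A), so it factors through some
    T_n, and one may suppose that it factors through all of them.  As Y/U lies
    in Ind^a(A), the arrow T_n -> Y -> Y/U lands in an object of A, and U is
    its kernel because U -> Y is the kernel of Y -> Y/U.  Now an arrow from
    T_n = lim T_{n,i} to an object of A factors through one T_{n,i}; its image
    r_n is then the same at all later i, because the transitions are
    epimorphisms, and so are the images d_n of S_n and the quotients
    c_n = r_n/d_n.  Taking kernels levelwise gives a diagram of Pro^a(A) with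
    exact rows and columns ([pro_const_3x3])

          W_n -> U   -> N_n
           |     |       |
          S_n -> T_n -> R_n
           |     |       |
          d_n -> r_n -> c_n

    whose bottom row is in A.  Since R_n -> R_m is a monomorphism, W_n and N_n
    do not depend on n ([stage_comparison]).  Hence the transitions of d, r and
    c are monomorphisms: they compare quotients of S_n, T_n, R_n and of
    S_m, T_m, R_m by the same subobject ([quotient_mono]).  In the colimit over
    n, W = ker(X -> colim d) is the pullback of X and U because colim d embeds
    in colim r, and N -> Z is an admissible monomorphism with quotient colim c,
    an object of Ind^a(A) ([lattice_image]).

    Pro^a(A) is the opposite of Ind^a(A^op), so the constructions are made for
    ind-objects, over a notion of abelian category that is its own dual, and
    dualized once.  Only zero arrows are needed to speak of kernels, and these,
    unlike sums of arrows, pass to ind-objects at once.  Finally W, N and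
    colim c are Beilinson objects, given by double systems that are constant in
    one of the two directions ([const_beilinson], [indpro_beilinson]). *)

Import Order.TTheory.

Set Implicit Arguments.
Unset Strict Implicit.
Unset Printing Implicit Defensive.
Local Open Scope cat_scope.

#[local] Existing Instance germ_eq_equiv.

Lemma dep_choice (I : Type) (X : I -> Type) (P : forall i, X i -> Prop) :
  (forall i, exists x, P i x) -> exists f : forall i, X i, forall i, P i (f i).
Proof.
move=> h; exists (fun i => sval (constructive_indefinite_description _ (h i))) => i.
exact: svalP (constructive_indefinite_description _ (h i)).
Qed.

(** * Zero arrows, kernels and cokernels *)

Record zeros (C : category) := Zeros {
  z0 : forall a b : C, hom a b;
  z0l : forall (a b c : C) (f : hom b c), f \oc z0 a b =~ z0 a c;
  z0r : forall (a b c : C) (f : hom a b), z0 b c \oc f =~ z0 a c }.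
Arguments z0 {C} z a b.

Definition epi (C : category) (a b : C) (f : hom a b) : Prop :=
  forall t (h k : hom b t), h \oc f =~ k \oc f -> h =~ k.

Definition zeros_op (C : category) (z : zeros C) : zeros (op C) :=
  @Zeros (op C) (fun a b => z0 z b a) (fun a b c f => z0r z a f)
    (fun a b c f => z0l z c f).

Section Kernels.
Variables (C : category) (z : zeros C).

(** Contains that i is a monomorphism, which for kernels in an additive category
    is the uniqueness of factorizations. *)
Definition zker (a b c : C) (i : hom a b) (p : hom b c) : Prop :=
  [/\ p \oc i =~ z0 z a c, mono i
    & forall t (h : hom t b), p \oc h =~ z0 z t c -> exists k, i \oc k =~ h].

Definition zcok (a b c : C) (i : hom a b) (p : hom b c) : Prop :=
  [/\ p \oc i =~ z0 z a c, epi p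
    & forall t (h : hom b t), h \oc i =~ z0 z a t -> exists k, k \oc p =~ h].

Lemma mono_comp (a b c : C) (f : hom a b) (g : hom b c) :
  mono f -> mono g -> mono (g \oc f).
Proof. by move=> mf mg t h k e; apply/mf/mg; rewrite !compA. Qed.

Lemma mono_right (a b c : C) (f : hom a b) (g : hom b c) :
  mono (g \oc f) -> mono f.
Proof. by move=> m t h k e; apply: m; rewrite -!compA e; reflexivity. Qed.

Lemma mono_heq (a b : C) (f g : hom a b) : f =~ g -> mono f -> mono g.
Proof. by move=> e m t h k; rewrite -e; apply: m. Qed.

Lemma iso_mono (a b : C) (f : hom a b) : is_iso f -> mono f.
Proof.
move=> [g [gf _]] t h k e.
by rewrite -(comp1m h) -(comp1m k) -gf -!compA e; reflexivity.
Qed.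

Lemma iso_id (a : C) : is_iso (idm a).
Proof. by exists (idm a); rewrite comp1m; split; reflexivity. Qed.

Lemma iso_comp (a b c : C) (f : hom a b) (g : hom b c) :
  is_iso f -> is_iso g -> is_iso (g \oc f).
Proof.
move=> [f' [e1 e2]] [g' [e3 e4]]; exists (f' \oc g'); split.
  by rewrite compA -(compA f') e3 compm1.
by rewrite compA -(compA g) e2 compm1.
Qed.

Lemma mono_z0 (a b c : C) (m : hom b c) (f : hom a b) :
  mono m -> m \oc f =~ z0 z a c -> f =~ z0 z a b.
Proof. by move=> mm e; apply: mm; rewrite e z0l; reflexivity. Qed.

(** Two kernels agree as soon as each of the two cokernel arrows kills the other
    kernel. *)
Lemma zker_uniq (a a' b c : C) (i : hom a b) (i' : hom a' b) (p : hom b c)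
    c' (p' : hom b c') :
  zker i p -> zker i' p' -> p \oc i' =~ z0 z a' c -> p' \oc i =~ z0 z a c' ->
  exists t : hom a a', is_iso t /\ i' \oc t =~ i.
Proof.
move=> [_ mi li] [_ mi' li'] e e'.
have [t et] := li' _ _ e'; have [t' et'] := li _ _ e.
exists t; split=> //; exists t'; split.
  by apply: mi; rewrite compA et' et compm1; reflexivity.
by apply: mi'; rewrite compA et et' compm1; reflexivity.
Qed.

Lemma iso_seq_sym (a b c a' b' c' : C) (i : hom a b) (p : hom b c)
    (i' : hom a' b') (p' : hom b' c') :
  iso_seq i p i' p' -> iso_seq i' p' i p.
Proof.
move=> [u [v [w [[[u' [u1 u2]] [v' [v1 v2]] [w' [w1 w2]]] [e1 e2]]]]].
exists u', v', w'; split; first by split; [exists u|exists v|exists w].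
split.
  rewrite -(compm1 (v' \oc i')) -u2 compA -(compA v') -e1 compA v1 comp1m.
  by reflexivity.
rewrite -(compm1 (w' \oc p')) -v2 compA -(compA w') -e2 compA w1 comp1m.
by reflexivity.
Qed.

Lemma iso_seq_trans (a b c a' b' c' a2 b2 c2 : C) (i : hom a b) (p : hom b c)
    (i' : hom a' b') (p' : hom b' c') (i2 : hom a2 b2) (p2 : hom b2 c2) :
  iso_seq i p i' p' -> iso_seq i' p' i2 p2 -> iso_seq i p i2 p2.
Proof.
move=> [u [v [w [[iu iv iw] [e1 e2]]]]] [u' [v' [w' [[iu' iv' iw'] [e3 e4]]]]].
exists (u' \oc u), (v' \oc v), (w' \oc w); split; first by split; apply: iso_comp.
by rewrite -!compA e1 e2 !compA e3 e4; split; reflexivity.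
Qed.

Lemma iso_seq_heq (a b c : C) (i i' : hom a b) (p p' : hom b c) :
  i =~ i' -> p =~ p' -> iso_seq i p i' p'.
Proof.
move=> ei ep; exists (idm a), (idm b), (idm c); split; first by split; apply: iso_id.
by rewrite !comp1m !compm1.
Qed.

Lemma zker_iso_seq (a b c a' b' c' : C) (i : hom a b) (p : hom b c)
    (i' : hom a' b') (p' : hom b' c') :
  iso_seq i p i' p' -> zker i p -> zker i' p'.
Proof.
move=> [u [v [w [[[u' [u1 u2]] [v' [v1 v2]] [w' [w1 w2]]] [e1 e2]]]]] [pi mi li].
split.
- rewrite -(compm1 (p' \oc i')) -u2 compA -(compA p') -e1 compA -e2 -(compA w) pi.
  by rewrite z0l z0r; reflexivity.
- apply: mono_heq (_ : mono (v \oc i \oc u')).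
    by rewrite e1 -compA u2 compm1; reflexivity.
  apply: mono_comp; first by apply: iso_mono; exists u.
  by apply: mono_comp mi _; apply: iso_mono; exists v'.
- move=> t h eh; have [] := li _ (v' \oc h).
    apply: (@mono_z0 _ _ _ w); first by apply: iso_mono; exists w'.
    by rewrite compA e2 compA -(compA p') v2 compm1.
  move=> k ek; exists (u \oc k).
  by rewrite compA -e1 -compA ek compA v2 comp1m; reflexivity.
Qed.

(** If v and i are kernels of q and q', and q f = j q' with j mono, then an
    arrow h to x whose image in y factors through v is killed by j q', hence by
    q', hence factors through i. *)
Lemma kernel_pullback (w x y u r d : C) (f : hom x y) (v : hom u y) (i : hom w x)
    (k : hom w u) (q : hom y r) (q' : hom x d) (j : hom d r) :
  zker v q -> zker i q' -> mono j -> q \oc f =~ j \oc q' ->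
  f \oc i =~ v \oc k -> is_pullback f v i k.
Proof.
move=> [vq mv _] [_ mi li] mj e e'; split=> // t h h' eh.
have [] := li _ h.
  apply: (mono_z0 mj); rewrite compA -e -compA eh compA vq z0r; reflexivity.
move=> l el; exists l; split; last first.
  by move=> l' [el' _]; apply: mi; rewrite el' el; reflexivity.
split=> //; apply: mv.
by rewrite compA -e' -compA el eh; reflexivity.
Qed.

(** The quotients of b and of a larger b' by the same subobject i: the arrow
    g : b/i -> b'/i is a monomorphism.  The proof uses no elements and no
    pushouts, only that the composite b -> b'/i has a kernel l and an image r.
    The kernel l is contained in i, and i in l because j is mono; so b/i and r
    are the same quotient of b, and g is j up to this identification. *)
Lemma quotient_mono (a b c b' c' r k : C) (i : hom a b) (p : hom b c) (m : hom b b')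
    (p' : hom b' c') (g : hom c c') (l : hom k b) (e : hom b r) (j : hom r c') :
  zcok i p -> mono m -> zker (m \oc i) p' -> g \oc p =~ p' \oc m ->
  zcok l e -> mono j -> g \oc p =~ j \oc e -> mono g.
Proof.
move=> [pi ep dp] mm [_ _ lm] gp [el ee de] mj je.
have [s es] : exists s, s \oc e =~ p.
  apply: de.
  (* m l dies in b'/i, so it factors through the kernel m i *)
  have [t et] : exists t, m \oc i \oc t =~ m \oc l.
    by apply: lm; rewrite compA -gp je -compA el z0l; reflexivity.
  have {}et : l =~ i \oc t by apply: mm; rewrite compA et; reflexivity.
  by rewrite et compA pi z0r; reflexivity.
have [s' es'] : exists s', s' \oc p =~ e.
  apply: dp; apply: (mono_z0 mj).
  by rewrite compA -je -compA pi z0l; reflexivity.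
have ss : s \oc s' =~ idm c.
  by apply: ep; rewrite -compA es' es comp1m; reflexivity.
have js : j \oc s' =~ g by apply: ep; rewrite -compA es' je; reflexivity.
apply: (mono_heq js); apply: mono_comp mj.
by move=> t h h' eh; rewrite -(comp1m h) -(comp1m h') -ss -!compA eh; reflexivity.
Qed.

End Kernels.

Lemma zcok_uniq (C : category) (z : zeros C) (a a' b c c' : C) (i : hom a b)
    (i' : hom a' b) (p : hom b c) (p' : hom b c') :
  zcok z i p -> zcok z i' p' -> p \oc i' =~ z0 z a' c -> p' \oc i =~ z0 z a c' ->
  exists t : hom c c', is_iso t /\ t \oc p =~ p'.
Proof.
move=> H H' e e'.
have [t [[t' [h1 h2]] et]] := @zker_uniq (op C) (zeros_op z) _ _ _ _ _ _ _ _ _ H' H e e'.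
by exists t; split=> //; exists t'.
Qed.

Lemma iso_seq_op (C : category) (a b c a' b' c' : C) (i : hom a b) (p : hom b c)
    (i' : hom a' b') (p' : hom b' c') :
  iso_seq i p i' p' -> @iso_seq (op C) _ _ _ _ _ _ p' i' p i.
Proof.
move=> [u [v [w [[iu iv iw] [e1 e2]]]]]; exists w, v, u; split; last first.
  by split; simpl; [rewrite e2 | rewrite e1]; reflexivity.
by split; [case: iw|case: iv|case: iu] => g [h1 h2]; exists g.
Qed.

Lemma zcok_iso_seq (C : category) (z : zeros C) (a b c a' b' c' : C)
    (i : hom a b) (p : hom b c) (i' : hom a' b') (p' : hom b' c') :
  iso_seq i p i' p' -> zcok z i p -> zcok z i' p'.
Proof.
by move=> /iso_seq_sym/iso_seq_op e; apply: (@zker_iso_seq (op C) (zeros_op z) _ _ _ _ _ _ _ _ _ _ e).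
Qed.

(** * Conflations as kernel-cokernel pairs *)

(** The part of the axioms of an exact category that is used for ind-objects and
    pro-objects. *)
Record kc (C : ccat) (z : zeros C) : Prop := Kc {
  kc_ker : forall (a b c : C) (i : hom a b) (p : hom b c), conf i p -> zker z i p;
  kc_cok : forall (a b c : C) (i : hom a b) (p : hom b c), conf i p -> zcok z i p;
  kc_iso : forall (a b c a' b' c' : C) (i : hom a b) (p : hom b c)
    (i' : hom a' b') (p' : hom b' c'), iso_seq i p i' p' -> conf i p -> conf i' p' }.

(** Exact categories in which every arrow has an image, with no reference to
    sums of arrows; the definition is invariant under passing to the opposite
    category. *)
Record abelian (C : ccat) (z : zeros C) : Prop := Abelian {
  ab_kc :> kc z;
  ab_fact : forall (a b : C) (f : hom a b), exists c (q : hom a c) (j : hom c b),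
    [/\ epi q, mono j & f =~ j \oc q];
  ab_mono : forall (a b : C) (i : hom a b), mono i -> adm_mono i;
  ab_epi : forall (a b : C) (p : hom a b), epi p -> adm_epi p }.

Lemma kc_op (C : ccat) (z : zeros C) : kc z -> @kc (cop C) (zeros_op z).
Proof.
move=> H; split.
- by move=> a b c i p h; exact: (kc_cok H h).
- by move=> a b c i p h; exact: (kc_ker H h).
- move=> a b c a' b' c' i p i' p' e h; apply: (kc_iso H) h.
  by apply: iso_seq_sym; exact: (@iso_seq_op (op C)) e.
Qed.

Lemma abelian_op (C : ccat) (z : zeros C) : abelian z -> @abelian (cop C) (zeros_op z).
Proof.
move=> H; split; first exact: (kc_op H).
- move=> a b f; have [c [q [j [eq mj e]]]] := ab_fact H f.
  by exists c, j, q.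
- by move=> a b i; exact: (ab_epi H).
- by move=> a b i; exact: (ab_mono H).
Qed.

Section Kc.
Variables (C : ccat) (z : zeros C) (H : kc z).

Lemma adm_mono_mono (a b : C) (i : hom a b) : adm_mono i -> mono i.
Proof. by move=> [c [p /(kc_ker H) []]]. Qed.

Lemma conf_heq (a b c : C) (i i' : hom a b) (p p' : hom b c) :
  i =~ i' -> p =~ p' -> conf i p -> conf i' p'.
Proof. by move=> e e'; apply/(kc_iso H)/iso_seq_heq. Qed.

Lemma conf_ker_iso (a a' b c : C) (i : hom a b) (p : hom b c) (i' : hom a' b)
    (t : hom a' a) :
  is_iso t -> i \oc t =~ i' -> conf i p -> conf i' p.
Proof.
move=> it e; apply/(kc_iso H)/iso_seq_sym.
exists t, (idm b), (idm c); split; first by split=> //; exact: iso_id.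
by rewrite !comp1m compm1 e; split; reflexivity.
Qed.

Lemma conf_cok_iso (a b c c' : C) (i : hom a b) (p : hom b c) (p' : hom b c')
    (t : hom c c') :
  is_iso t -> t \oc p =~ p' -> conf i p -> conf i p'.
Proof.
move=> it e; apply: (kc_iso H).
exists (idm a), (idm b), t; split; first by split=> //; exact: iso_id.
by rewrite !comp1m !compm1 e; split; reflexivity.
Qed.

Lemma conf_mid_iso (a b b' c : C) (i : hom a b) (p : hom b c) (i' : hom a b')
    (p' : hom b' c) (t : hom b b') :
  is_iso t -> t \oc i =~ i' -> p' \oc t =~ p -> conf i p -> conf i' p'.
Proof.
move=> it e e'; apply: (kc_iso H).
exists (idm a), t, (idm c); split; first by split=> //; exact: iso_id.
by rewrite !comp1m !compm1 e e'; split; reflexivity.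
Qed.

Lemma zker_conf (a b c : C) (i : hom a b) (p : hom b c) :
  zker z i p -> adm_epi p -> conf i p.
Proof.
move=> K [a' [i' h]]; have K' := kc_ker H h.
have [t [it et]] := zker_uniq K K' (let: And3 e _ _ := K' in e) (let: And3 e _ _ := K in e).
exact: conf_ker_iso it et h.
Qed.

Lemma zcok_conf (a b c : C) (i : hom a b) (p : hom b c) :
  zcok z i p -> adm_mono i -> conf i p.
Proof.
move=> K [c' [p' h]]; have K' := kc_cok H h.
have [t [it et]] := zcok_uniq K' K (let: And3 e _ _ := K' in e) (let: And3 e _ _ := K in e).
exact: conf_cok_iso it et h.
Qed.

End Kc.

Section Abelian.
Variables (C : ccat) (z : zeros C) (H : abelian z).

Lemma ab_cokernel (a b : C) (f : hom a b) : exists k (l : hom k a) r (e : hom a r) (j : hom r b),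
  [/\ conf l e, mono j & f =~ j \oc e].
Proof.
have [r [e [j [ee mj ef]]]] := ab_fact H f.
by have [k [l h]] := ab_epi H ee; exists k, l, r, e, j.
Qed.

(** The 3x3 lemma for a monomorphism of short exact sequences, in the form that
    the three quotients of its columns form a short exact sequence.  The object
    W is taken to be the image of S -> T/r, which makes W -> K a monomorphism;
    what has to be seen is that S -> W is the quotient by c. *)
Lemma quotient_conf (S T R c r d : C) (s : hom S T) (p : hom T R)
    (cr : hom c r) (rd : hom r d) (jS : hom c S) (jT : hom r T) (jR : hom d R) :
  conf s p -> conf cr rd -> mono jT -> mono jR ->
  s \oc jS =~ jT \oc cr -> p \oc jT =~ jR \oc rd ->
  exists W K N (qS : hom S W) (qT : hom T K) (qR : hom R N)
    (w : hom W K) (n : hom K N),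
    [/\ conf jS qS, conf jT qT, conf jR qR & conf w n] /\
    w \oc qS =~ qT \oc s /\ n \oc qT =~ qR \oc p.
Proof.
move=> hsp hcd mT mR e1 e2.
have [ps ms ls] := kc_ker H hsp; have [_ ep dp] := kc_cok H hsp.
have [_ mc lc] := kc_ker H hcd; have [_ ed _] := kc_cok H hcd.
have [K [qT hT]] := ab_mono H mT; have [N [qR hR]] := ab_mono H mR.
have [eT _ lT] := kc_ker H hT; have [eR eqR dR] := kc_cok H hR.
have [_ eqT dT] := kc_cok H hT.
(* W is the image of S in T/r *)
have [W [qS [w [eqS mw ew]]]] := ab_fact H (qT \oc s).
have [n en] : exists n, n \oc qT =~ qR \oc p.
  by apply: dT; rewrite -compA e2 compA eR z0r; reflexivity.
exists W, K, N, qS, qT, qR, w, n; split; last by split=> //; rewrite ew; reflexivity.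
split=> //.
- apply: (zker_conf H); last exact: (ab_epi H).
  split.
  + apply: (mono_z0 mw); rewrite compA -ew -compA e1 compA eT z0r; reflexivity.
  + apply: (@mono_right _ _ _ _ _ s); apply: mono_heq (_ : mono (jT \oc cr)).
      by rewrite e1; reflexivity.
    exact: mono_comp.
  + move=> t h eh; have [k ek] : exists k, jT \oc k =~ s \oc h.
      by apply: lT; rewrite compA ew -compA eh z0l; reflexivity.
    have [l el] : exists l, cr \oc l =~ k.
      apply: lc; apply: (mono_z0 mR).
      by rewrite compA -e2 -compA ek compA ps z0r; reflexivity.
    by exists l; apply: ms; rewrite compA e1 -compA el ek; reflexivity.
- apply: (zcok_conf H); last exact: (ab_mono H).
  split.
  + apply: eqS; rewrite -compA -ew compA en -compA ps z0l z0r; reflexivity.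
  + apply: (@mono_right (op C) _ _ _ n qT).
    apply: (@mono_heq (op C) _ _ (qR \oc p)); first by rewrite /= en; reflexivity.
    exact: (@mono_comp (op C)).
  + move=> t h eh.
    have [k ek] : exists k, k \oc p =~ h \oc qT.
      by apply: dp; rewrite -compA ew compA eh z0r; reflexivity.
    have [l el] : exists l, l \oc qR =~ k.
      apply: dR; apply: ed.
      by rewrite -compA -e2 compA ek -compA eT z0l z0r; reflexivity.
    by exists l; apply: eqT; rewrite -compA en compA el ek; reflexivity.
Qed.

End Abelian.

(** * Germs and arrows of ind-objects *)

Section IndArrows.
Variable C : category.
Implicit Types (a b : C) (X Y Z : Ind C).

Definition mkgerm (Y : ind_ob C) a j (f : hom a (Y j)) : germ a Y :=
  Tagged (fun j => hom a (Y j)) f.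

Lemma germ_preM (Y : ind_ob C) a b c (w : germ c Y) (f : hom b c) (g : hom a b) :
  germ_eq (germ_pre (germ_pre w f) g) (germ_pre w (f \oc g)).
Proof. by apply: germ_eqE => /=; rewrite compA; reflexivity. Qed.

Lemma germ_pre1 (Y : ind_ob C) a (w : germ a Y) : germ_eq (germ_pre w (idm a)) w.
Proof. by case: w => j f; apply: germ_eqE => /=; exact: compm1. Qed.

Lemma germ_post_pre (Y Z : ind_ob C) a b (g : ind_hom Y Z) (w : germ b Y) (f : hom a b) :
  germ_eq (germ_post g (germ_pre w f)) (germ_pre (germ_post g w) f).
Proof. by rewrite /germ_post; apply: germ_eqE => /=; rewrite compA; reflexivity. Qed.

(** Arrows from a constant object and germs are the same thing; this lets
    computations with germs be done with composition of arrows. *)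
Definition of_germ a (Y : Ind C) (w : germ a Y) : hom (ind_const a) Y.
Proof.
exists (fun _ => w) => i j h; symmetry; exact: germ_pre1.
Defined.

Lemma of_germ_eq a (Y : Ind C) (w w' : germ a Y) :
  germ_eq w w' -> of_germ w =~ of_germ w'.
Proof. by move=> e i. Qed.

Lemma of_germK a (Y : Ind C) (f : hom (ind_const a) Y) : f =~ of_germ (f tt).
Proof. by case=> /=; reflexivity. Qed.

Lemma comp_of_germ a (Y Z : Ind C) (g : hom Y Z) (w : germ a Y) :
  g \oc of_germ w =~ of_germ (germ_post g w).
Proof. by case=> /=; reflexivity. Qed.

Lemma of_germ_const a b (Y : Ind C) (w : germ b Y) (f : hom a b) :
  of_germ w \oc ind_const_hom f =~ of_germ (germ_pre w f).
Proof. by case=> /=; reflexivity. Qed.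

Lemma ind_const_comp a b c (g : hom b c) (f : hom a b) :
  ind_const_hom (g \oc f) =~ ind_const_hom g \oc ind_const_hom f.
Proof. by case=> /=; reflexivity. Qed.

Lemma ind_const_id a : ind_const_hom (idm a) =~ idm (ind_const a).
Proof. by case=> /=; reflexivity. Qed.

Lemma ind_const_heq a b (f g : hom a b) :
  f =~ g -> ind_const_hom f =~ ind_const_hom g.
Proof. by move=> e; case; apply: germ_eqE. Qed.

Lemma ind_const_full a b (f : hom (ind_const a) (ind_const b)) :
  exists f0 : hom a b, f =~ ind_const_hom f0.
Proof.
case E: (f tt) => [[] f0]; exists f0; case=> /=; rewrite E; reflexivity.
Qed.

Lemma ind_const_faithful a b (f g : hom a b) :
  ind_const_hom f =~ ind_const_hom g -> f =~ g.
Proof. by move=> /(_ tt) [[] [h [h']]] /=; rewrite !comp1m. Qed.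

(** Injectivity on germs, a form of monomorphism that can be tested at one term
    of the system at a time. *)
Definition ginj (X Y : Ind C) (f : hom X Y) : Prop :=
  forall a (w w' : germ a X),
    germ_eq (germ_post f w) (germ_post f w') -> germ_eq w w'.

Lemma ginj_mono X Y (f : hom X Y) : ginj f -> mono f.
Proof. by move=> fi t h k e i; apply: fi; apply: e. Qed.

(** An arrow of ind-objects is a compatible family of germs.  Along an arrow
    that is injective on germs compatibility is automatic, so it suffices to
    lift each germ separately. *)
Lemma ind_lift T X Y (f : hom X Y) (h : hom T Y) : ginj f ->
  (forall t, exists w : germ (ind_diag T t) X, germ_eq (germ_post f w) (icomp h t)) ->
  exists k : hom T X, f \oc k =~ h.
Proof.
move=> fi hw.
pose k t := sval (constructive_indefinite_description _ (hw t)).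
have kP t : germ_eq (germ_post f (k t)) (icomp h t).
  exact: svalP (constructive_indefinite_description _ (hw t)).
unshelve eexists.
  exists k => i j le; apply: fi.
  rewrite kP germ_post_pre; transitivity (germ_pre (icomp h j) (dmap (ind_diag T) le)).
    exact: icompat.
  by apply: germ_pre_eq; [symmetry; exact: kP|reflexivity].
by move=> t; exact: kP.
Qed.

Lemma ind_iso X Y (f : hom X Y) : ginj f ->
  (forall i, exists w : germ (ind_diag Y i) X, germ_eq (germ_post f w) (mkgerm (idm (ind_diag Y i)))) ->
  is_iso f.
Proof.
move=> fi hw; have [g eg] := @ind_lift Y X Y f (idm Y) fi hw.
exists g; split=> //; apply: (ginj_mono fi).
by rewrite compA eg comp1m compm1; reflexivity.
Qed.

Definition mono_trans (I : preord) (D : diagram C I) : Prop :=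
  forall i j (h : ple i j), mono (dmap D h).

(** When the transitions are monomorphisms, two representatives at the same term
    that agree later agree already. *)
Lemma germ_inj (Y : Ind C) a j (f g : hom a (ind_diag Y j)) : mono_trans (ind_diag Y) ->
  germ_eq (mkgerm f) (mkgerm g) -> f =~ g.
Proof.
move=> m [k [h [h' /=]]] e; apply: (m _ _ h).
rewrite e; rewrite (dmap_irr _ h' h); reflexivity.
Qed.

(** Passing to a cofinal index.  All the changes of presentation below are
    instances: restriction to the terms after a given one, constant systems on
    two index sets, and the rows and columns of Beilinson systems. *)
Lemma reindex (I J : preord) (dI : directed I) (dJ : directed J)
    (D : diagram C I) (E : diagram C J) (s : J -> I) (th : forall j, hom (E j) (D (s j))) :
  (forall j, is_iso (th j)) ->
  (forall i, exists j, ple i (s j)) ->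
  (forall j j', ple j j' -> ple (s j) (s j')) ->
  (forall j j' (h : ple j j') (h' : ple (s j) (s j')),
     dmap D h' \oc th j =~ th j' \oc dmap E h) ->
  exists f : @hom (Ind C) (IndOb dJ E) (IndOb dI D),
    is_iso f /\ forall j, icomp f j = Tagged (fun i => hom (E j) (D i)) (th j).
Proof.
move=> ith cof smon nat_th.
unshelve eexists.
  exists (fun j => Tagged (fun i => hom (E j) (D i)) (th j)) => j j' h.
  have h' := smon _ _ h.
  exists (s j'), h', (ple_refl (s j')) => /=.
  by rewrite nat_th dmap1 comp1m; reflexivity.
split=> //; apply: ind_iso.
- move=> a [j w] [j' w'] [i [/= h [h' e]]].
  (* an index k of E after j and j' whose image is after i *)
  have [k1 [jk1 j'k1]] := dJ.2 j j'; have [k2 ik2] := cof i.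
  have [k [k1k k2k]] := dJ.2 k1 k2.
  have jk := ple_trans jk1 k1k; have j'k := ple_trans j'k1 k1k.
  exists k, jk, j'k => /=; apply: (iso_mono (ith k)).
  have sk := smon _ _ k2k; have ik := ple_trans ik2 sk.
  have sjk := smon _ _ jk; have sj'k := smon _ _ j'k.
  rewrite !compA -(nat_th _ _ jk sjk) -(nat_th _ _ j'k sj'k).
  rewrite -(dmapM D h ik) -(dmapM D h' ik) -!compA e; reflexivity.
- move=> i; have [j ij] := cof i; have [g [_ eg]] := ith j.
  exists (mkgerm (Y := IndOb dJ E) (g \oc dmap D ij)).
  exists (s j), (ple_refl (s j)), ij => /=.
  by rewrite (compA (th j)) eg comp1m compm1 dmap1 comp1m; reflexivity.
Qed.

End IndArrows.

(** * Zero arrows and kernels of ind-objects *)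

Definition pick (C : category) (Y : ind_ob C) : index Y :=
  epsilon (index_directed Y).1 (fun=> True).

Definition zeros_full (C : category) (z : zeros C) (P : C -> Prop) : zeros (full_sub P) :=
  @Zeros (full_sub P) (fun a b => z0 z (sval a) (sval b))
    (fun a b c f => z0l z (sval a) f) (fun a b c f => z0r z (sval c) f).

Lemma iso_seq_full (C : category) (P : C -> Prop) (a b c a' b' c' : full_sub P)
    (i : hom a b) (p : hom b c) (i' : hom a' b') (p' : hom b' c') :
  iso_seq i p i' p' ->
  @iso_seq C (sval a) (sval b) (sval c) (sval a') (sval b') (sval c') i p i' p'.
Proof. by []. Qed.

Section IndZeros.
Variables (C : category) (z : zeros C).

Definition germ0 (a : C) (Y : ind_ob C) : germ a Y := mkgerm (z0 z a (Y (pick Y))).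

Lemma germ0E a (Y : ind_ob C) j (f : hom a (Y j)) :
  f =~ z0 z a (Y j) -> germ_eq (mkgerm f) (germ0 a Y).
Proof.
move=> e; have [k [h h']] := (index_directed Y).2 j (pick Y).
by exists k, h, h'; rewrite /= e !z0l; reflexivity.
Qed.

Lemma germ0_pre a b (Y : ind_ob C) (f : hom a b) :
  germ_eq (germ_pre (germ0 b Y) f) (germ0 a Y).
Proof. by apply: germ0E; exact: z0r. Qed.

Lemma germ0_post a (Y Z : ind_ob C) (g : ind_hom Y Z) :
  germ_eq (germ_post g (germ0 a Y)) (germ0 a Z).
Proof. by apply: germ0E; exact: z0l. Qed.

Lemma germ0P a (Y : ind_ob C) j (f : hom a (Y j)) :
  germ_eq (mkgerm f) (germ0 a Y) -> exists k (h : ple j k), dmap Y h \oc f =~ z0 z a (Y k).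
Proof. by move=> [k [h [h' /= e]]]; exists k, h; rewrite e z0l; reflexivity. Qed.

Lemma germ0_inj a (Y : ind_ob C) j (f : hom a (Y j)) : mono_trans Y ->
  germ_eq (mkgerm f) (germ0 a Y) -> f =~ z0 z a (Y j).
Proof. by move=> m /germ0P [k [h e]]; exact: mono_z0 (m _ _ h) e. Qed.

Definition ind_z0 (X Y : ind_ob C) : ind_hom X Y.
Proof.
exists (fun i => germ0 (X i) Y) => i j h; symmetry; exact: germ0_pre.
Defined.

Definition zeros_ind : zeros (Ind C).
Proof.
refine (@Zeros (Ind C) ind_z0 _ _).
- by move=> a b c f i; exact: germ0_post.
- by move=> a b c f i; case: (icomp f i) => j g; exact: germ0_pre.
Defined.

Variables (I : preord) (dI : directed I) (S T R : diagram C I)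
  (i : forall n, hom (S n) (T n)) (p : forall n, hom (T n) (R n))
  (nat_i : forall n m (h : ple n m), dmap T h \oc i n =~ i m \oc dmap S h)
  (nat_p : forall n m (h : ple n m), dmap R h \oc p n =~ p m \oc dmap T h).

(** Strictness is what makes kernels of ind-objects levelwise: an arrow to T_n
    that dies in a later R_m dies in R_n, since R_n -> R_m is mono. *)
Lemma level_zker : (forall n, zker z (i n) (p n)) -> mono_trans R ->
  zker zeros_ind (level_hom dI nat_i) (level_hom dI nat_p).
Proof.
move=> K mR.
have gi : ginj (level_hom dI nat_i).
  move=> a [n w] [n' w'] [k [/= h [h' e]]]; exists k, h, h' => /=.
  have [_ mk _] := K k; apply: mk.
  by rewrite !compA -!nat_i -!compA e; reflexivity.
split.
- by move=> n; apply: germ0E => /=; have [e _ _] := K n.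
- exact: ginj_mono.
- move=> t h e; apply: (ind_lift gi) => j.
  have := e j; rewrite /= /germ_post; case: (icomp h j) => n w /= e0.
  have [pi _ li] := K n; have [] := li _ w.
    exact: (germ0_inj (Y := IndOb dI R) mR e0).
  move=> k ek; exists (mkgerm (Y := IndOb dI S) k).
  by apply: (germ_eqE (Y := IndOb dI T)).
Qed.

(** The germ at n of an arrow killing S dies on S_n only after a transition of
    the target; replacing it by its image under that transition, it factors
    through R_n. *)
Lemma level_zcok : (forall n, zcok z (i n) (p n)) ->
  zcok zeros_ind (level_hom dI nat_i) (level_hom dI nat_p).
Proof.
move=> K; split.
- by move=> n; apply: germ0E => /=; have [e _ _] := K n.
- move=> t h k e n; have [_ en _] := K n.
  move: (e n); rewrite /= /germ_post /=.
  case: (icomp h n) (icomp k n) => j u [j' u'] [l [/= g [g' e']]].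
  by exists l, g, g'; apply: en => /=; rewrite -!compA.
- move=> t h e.
  have ex n : exists w : germ (R n) t, germ_eq (germ_pre w (p n)) (icomp h n).
    have [_ en dn] := K n.
    have := e n; rewrite /= /germ_post /=; case: (icomp h n) => j u.
    move=> /germ0P [k [g eg]].
    have [|v ev] := dn _ (dmap (ind_diag t) g \oc u); first by rewrite -compA.
    exists (mkgerm v); symmetry; exists k, g, (ple_refl k).
    by rewrite /= dmap1 comp1m ev; reflexivity.
  pose k n := sval (constructive_indefinite_description _ (ex n)).
  have kP n : germ_eq (germ_pre (k n) (p n)) (icomp h n).
    exact: svalP (constructive_indefinite_description _ (ex n)).
  have inj n (w w' : germ (R n) t) :
      germ_eq (germ_pre w (p n)) (germ_pre w' (p n)) -> germ_eq w w'.
    move=> [l [g [g' /= eg]]]; exists l, g, g'.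
    by have [_ en _] := K n; apply: en; rewrite -!compA.
  unshelve eexists.
    exists k => n m le; apply: inj; rewrite kP germ_preM.
    transitivity (germ_pre (k m) (p m \oc dmap T le)).
      rewrite -germ_preM; transitivity (germ_pre (icomp h m) (dmap T le)).
        exact: (icompat h le).
      by apply: germ_pre_eq; [symmetry; exact: kP|reflexivity].
    by apply: germ_pre_eq; [reflexivity | rewrite nat_p; reflexivity].
  by move=> n; exact: kP.
Qed.

End IndZeros.

(** * Conflations of ind-objects *)

Section IndConf.
Variable C : ccat.

(** The condition of [inda_conf], which makes sense for all ind-objects; using it
    on [Ind C] avoids carrying membership in the subcategory. *)
Definition ind_conf (X Y Z : Ind C) (f : hom X Y) (g : hom Y Z) : Prop :=
  exists (I : preord) (dI : directed I) (S T R : diagram C I)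
    (i : forall n, hom (S n) (T n)) (p : forall n, hom (T n) (R n))
    (nat_i : forall n m (h : ple n m), dmap T h \oc i n =~ i m \oc dmap S h)
    (nat_p : forall n m (h : ple n m), dmap R h \oc p n =~ p m \oc dmap T h),
    [/\ inda_ob (IndOb dI S), inda_ob (IndOb dI T) & inda_ob (IndOb dI R)] /\
    (forall n, conf (i n) (p n)) /\
    @iso_seq (Ind C) _ _ _ _ _ _ f g
      (level_hom dI nat_i) (level_hom dI nat_p).

Lemma ind_conf_iso (X Y Z X' Y' Z' : Ind C) (f : hom X Y) (g : hom Y Z)
    (f' : hom X' Y') (g' : hom Y' Z') :
  iso_seq f g f' g' -> ind_conf f g -> ind_conf f' g'.
Proof.
move=> e [I [dI [S [T [R [i [p [ni [np [obs [c e']]]]]]]]]]].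
exists I, dI, S, T, R, i, p, ni, np; split=> //; split=> //.
exact: iso_seq_trans (iso_seq_sym e) e'.
Qed.

Variables (z : zeros C) (H : kc z).

Lemma inda_mono (X : Ind C) : inda_ob X -> mono_trans (ind_diag X).
Proof. by move=> [_ h] i j le; apply: (adm_mono_mono H). Qed.

Lemma ind_conf_zker (X Y Z : Ind C) (f : hom X Y) (g : hom Y Z) :
  ind_conf f g -> zker (zeros_ind z) f g.
Proof.
move=> [I [dI [S [T [R [i [p [ni [np [[oS oT oR] [c e]]]]]]]]]]].
apply: zker_iso_seq (iso_seq_sym e) _; apply: level_zker.
  by move=> n; exact: (kc_ker H).
exact: (inda_mono oR).
Qed.

Lemma ind_conf_zcok (X Y Z : Ind C) (f : hom X Y) (g : hom Y Z) :
  ind_conf f g -> zcok (zeros_ind z) f g.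
Proof.
move=> [I [dI [S [T [R [i [p [ni [np [[oS oT oR] [c e]]]]]]]]]]].
apply: zcok_iso_seq (iso_seq_sym e) _; apply: level_zcok.
by move=> n; exact: (kc_cok H).
Qed.

End IndConf.

(** Applied to [cop A] and dualized it gives kernels and cokernels in the category
    of pro-objects. *)
Lemma kc_inda (C : ccat) (z : zeros C) : kc z ->
  @kc (Inda C) (@zeros_full (Ind C) (zeros_ind z) (@inda_ob C)).
Proof.
move=> H; split.
- move=> a b c i p h; have [e m l] := ind_conf_zker H (h : ind_conf i p).
  split=> //; first by move=> t; apply: m.
  by move=> t; apply: l.
- move=> a b c i p h; have [e m l] := ind_conf_zcok H (h : ind_conf i p).
  split=> //; first by move=> t; apply: m.
  by move=> t; apply: l.
- move=> a b c a' b' c' i p i' p' /iso_seq_full e h.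
  exact: (ind_conf_iso (C := C) e h).
Qed.

(** * Presentations with a least index *)

Definition above (I : preord) (n0 : I) : preord.
Proof.
refine (@Preord {n : I | ple n0 n} (fun a b => ple (sval a) (sval b)) _ _).
- by move=> i; exact: ple_refl.
- by move=> i j k; exact: ple_trans.
Defined.

Lemma above_directed (I : preord) (n0 : I) : directed I -> directed (above n0).
Proof.
move=> dI; split; first exact: (inhabits (exist _ n0 (ple_refl n0))).
move=> [i hi] [j hj]; have [k [ik jk]] := dI.2 i j.
by exists (exist _ k (ple_trans hi ik)).
Qed.

Lemma above_countable (I : preord) (n0 : I) : countable_index I -> countable_index (above n0).
Proof.
move=> [f fi]; exists (fun i => f (sval i)) => -[i hi] [j hj] /= /fi e.
by case: _ / e hj => hj; rewrite (proof_irrelevance _ hi hj).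
Qed.

Definition restr (C : category) (I : preord) (n0 : I) (D : diagram C I) :
    diagram C (above n0) :=
  @Diagram C (above n0) (fun n => D (sval n)) (fun i j h => dmap D h)
    (fun i h => dmap1 D h) (fun i j k h h' h'' => dmapM D h h' h'').

Definition const_diag (C : category) (I : preord) (a : C) : diagram C I :=
  @Diagram C I (fun=> a) (fun _ _ _ => idm a) (fun _ _ => reflexivity _)
    (fun _ _ _ _ _ _ => comp1m _).

Lemma restr_iso (C : category) (I : preord) (dI : directed I) (n0 : I)
    (D : diagram C I) :
  exists f : @hom (Ind C) (IndOb (above_directed n0 dI) (restr n0 D)) (IndOb dI D),
    is_iso f /\ forall j, icomp f j = Tagged (fun i => hom (D (sval j)) (D i)) (idm _).
Proof.
apply: (@reindex C I (above n0) dI (above_directed n0 dI) D (restr n0 D)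
  (fun n => sval n) (fun n => idm (D (sval n)))).
- by move=> j; exact: iso_id.
- move=> i; have [k [ik nk]] := dI.2 i n0.
  by exists (exist _ k nk).
- by [].
- move=> j j' h h' /=; rewrite compm1 comp1m; exact: dmap_irr.
Qed.

Lemma const_diag_iso (C : category) (I : preord) (dI : directed I) (a : C) :
  exists f : @hom (Ind C) (IndOb dI (const_diag I a)) (ind_const a),
    is_iso f /\ forall j, icomp f j = mkgerm (Y := ind_const a) (j := tt) (idm a).
Proof.
apply: (@reindex C unit_preord I unit_directed dI (ind_diag (ind_const a))
  (const_diag I a) (fun=> tt) (fun=> idm a)).
- by move=> j; exact: iso_id.
- by move=> i; case: dI.1 => j; exists j.
- by [].
- by move=> j j' h h' /=; reflexivity.
Qed.

Section Presentations.
Variable C : ccat.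

(** A conflation with an arrow u from a constant object to its middle term: u
    is represented at some n0, and restricting to the terms after n0 makes n0 the
    least index, so that u is represented at every term. *)
Lemma conf_presentation (X Y Z : Ind C) (f : hom X Y) (g : hom Y Z) a (u : hom (ind_const a) Y) :
  ind_conf f g ->
  exists (I : preord) (dI : directed I) (cI : countable_index I) (n0 : I)
    (le0 : forall n, ple n0 n) (S T R : diagram C I)
    (s : forall n, hom (S n) (T n)) (p : forall n, hom (T n) (R n))
    (nat_s : forall n m (h : ple n m), dmap T h \oc s n =~ s m \oc dmap S h)
    (nat_p : forall n m (h : ple n m), dmap R h \oc p n =~ p m \oc dmap T h)
    (al : @hom (Ind C) (IndOb dI S) X) (be : @hom (Ind C) (IndOb dI T) Y)
    (ga : @hom (Ind C) (IndOb dI R) Z) (u0 : hom a (T n0)),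
    [/\ inda_ob (IndOb dI S), inda_ob (IndOb dI T), inda_ob (IndOb dI R)
      & forall n, conf (s n) (p n)] /\
    [/\ is_iso al, is_iso be & is_iso ga] /\
    [/\ f \oc al =~ be \oc level_hom dI nat_s,
        g \oc be =~ ga \oc level_hom dI nat_p
      & u =~ be \oc of_germ (mkgerm (Y := IndOb dI T) u0)].
Proof.
move=> [I [dI [S [T [R [s [p [ns [np [[oS oT oR] [c e]]]]]]]]]]].
have [al [be [ga [[ia [be' [b1 b2]] ic] [e1 e2]]]]] := iso_seq_sym e.
have [[n0 u0] eu] : exists w, be' \oc u =~ of_germ w by eexists; exact: of_germK.
have [rS [iS eS]] := restr_iso dI n0 S.
have [rT [iT eT]] := restr_iso dI n0 T.
have [rR [iR eR]] := restr_iso dI n0 R.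
unshelve eexists (above n0), (above_directed n0 dI), (@above_countable I n0 oS.1),
  (exist (fun n : I => ple n0 n) n0 (ple_refl n0)), _, (restr n0 S), (restr n0 T), (restr n0 R),
  (fun n => s (sval n)), (fun n => p (sval n)), _, _, (al \oc rS), (be \oc rT),
  (ga \oc rR), u0.
- by move=> [n hn].
- by move=> n m h; exact: ns.
- by move=> n m h; exact: np.
have H D : @inda_ob C (IndOb dI D) -> @inda_ob C (IndOb (above_directed n0 dI) (restr n0 D)).
  by move=> [h1 h2]; split; [exact: above_countable | move=> i j h; exact: h2].
split; first by split; try exact: H; move=> n; exact: c.
split; first by split; apply: iso_comp => //; exists be'.
have L (D E : diagram C I) (t : forall n, hom (D n) (E n)) nt nt'
   (rD : @hom (Ind C) (IndOb (above_directed n0 dI) (restr n0 D)) (IndOb dI D))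
   (rE : @hom (Ind C) (IndOb (above_directed n0 dI) (restr n0 E)) (IndOb dI E)) :
   (forall j, icomp rD j = Tagged (fun i => hom (D (sval j)) (D i)) (idm _)) ->
   (forall j, icomp rE j = Tagged (fun i => hom (E (sval j)) (E i)) (idm _)) ->
   @level_hom C I dI D E t nt \oc rD =~
     rE \oc @level_hom C _ (above_directed n0 dI) (restr n0 D) (restr n0 E) (fun n => t (sval n)) nt'.
  move=> hD hE j; rewrite /= hD /germ_post /= hE /=.
  apply: (germ_eqE (Y := IndOb dI E)); rewrite compm1 comp1m; reflexivity.
split.
- rewrite compA -e1 -!compA; apply: comp_heq; first by reflexivity.
  by apply: L.
- rewrite compA -e2 -!compA; apply: comp_heq; first by reflexivity.
  by apply: L.
- rewrite -(comp1m u) -b2 -!compA eu; apply: comp_heq; first by reflexivity.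
  rewrite comp_of_germ; apply: of_germ_eq; rewrite /germ_post /= eT.
  by apply: (germ_eqE (Y := IndOb dI T)) => /=; rewrite comp1m; reflexivity.
Qed.

(** As n0 is the least index, a is a subobject of every D_n, and the constant
    object a is the colimit of the constant system indexed by I. *)
Lemma const_conf (I : preord) (dI : directed I) (n0 : I) (le0 : forall n, ple n0 n)
    (D E : diagram C I) (q : forall n, hom (D n) (E n))
    (nat_q : forall n m (h : ple n m), dmap E h \oc q n =~ q m \oc dmap D h)
    (a : C) (j0 : hom a (D n0)) (X : Ind C) (al : @hom (Ind C) (IndOb dI D) X)
    (g : @hom (Ind C) X (IndOb dI E)) :
  inda_ob (IndOb dI D) -> inda_ob (IndOb dI E) -> adm_mono (idm a) ->
  (forall n, conf (dmap D (le0 n) \oc j0) (q n)) ->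
  is_iso al -> g \oc al =~ level_hom dI nat_q ->
  ind_conf (al \oc of_germ (mkgerm (Y := IndOb dI D) j0)) g.
Proof.
move=> oD oE ma cf ial eg.
have nat_j n m (h : ple n m) : dmap D h \oc (dmap D (le0 n) \oc j0) =~
    dmap D (le0 m) \oc j0 \oc dmap (const_diag I a) h.
  by rewrite /= compm1 compA (dmapM D _ _ (le0 m)); reflexivity.
have [k [ik ek]] := const_diag_iso dI a.
exists I, dI, (const_diag I a), D, E, (fun n => dmap D (le0 n) \oc j0), q, nat_j, nat_q.
split; first by split=> //; split; [exact: oD.1 | move=> i j h; exact: ma].
split=> //; apply: iso_seq_sym.
exists k, al, (idm (IndOb dI E : Ind C)); split.
  by split=> //; exact: iso_id.
split; last by rewrite comp1m eg; reflexivity.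
rewrite -compA; apply: comp_heq; first by reflexivity.
move=> n; rewrite /= ek /germ_post /=; symmetry.
exists n, (le0 n), (ple_refl n) => /=.
by rewrite dmap1 comp1m compm1; reflexivity.
Qed.

Variables (z : zeros C) (H : kc z).

(** The quotients of the terms of a system by a fixed subobject form a system
    of monomorphisms.  The third hypothesis provides the kernels and images asked
    for by [quotient_mono]; it is phrased only for arrows to the quotients E_n
    because in the category of pro-objects it holds when these lie in A. *)
Lemma quotient_system (I : preord) (n0 : I) (le0 : forall n, ple n0 n)
    (D : diagram C I) (E : I -> C) (q : forall n, hom (D n) (E n))
    (a : C) (j0 : hom a (D n0)) :
  mono_trans D ->
  (forall n, conf (dmap D (le0 n) \oc j0) (q n)) ->
  (forall n n' (psi : hom (D n) (E n')),
     exists k (l : hom k (D n)) r (e : hom (D n) r) (j : hom r (E n')),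
     [/\ conf l e, mono j & psi =~ j \oc e]) ->
  exists (dm : forall i j, ple i j -> hom (E i) (E j))
    (l1 : forall i (h : ple i i), dm i i h =~ idm (E i))
    (lM : forall i j k (h : ple i j) (h' : ple j k) (h'' : ple i k),
       dm j k h' \oc dm i j h =~ dm i k h''),
    (forall i j (h : ple i j), dm i j h \oc q i =~ q j \oc dmap D h) /\
    (forall i j (h : ple i j), mono (dm i j h)).
Proof.
move=> mD cf fact.
have lD i j (h : ple i j) : dmap D h \oc (dmap D (le0 i) \oc j0) =~ dmap D (le0 j) \oc j0.
  by rewrite compA (dmapM D _ _ (le0 j)); reflexivity.
have ex i j (h : ple i j) : exists g, g \oc q i =~ q j \oc dmap D h.
  have [_ _ d] := kc_cok H (cf i); apply: d.
  by rewrite -compA lD; have [] := kc_cok H (cf j).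
have ei i : epi (q i) by have [] := kc_cok H (cf i).
pose dm i j h := sval (constructive_indefinite_description _ (ex i j h)).
have dmP i j h : dm i j h \oc q i =~ q j \oc dmap D h.
  exact: svalP (constructive_indefinite_description _ (ex i j h)).
unshelve eexists dm, _, _.
- move=> i h; apply: ei; rewrite dmP dmap1 comp1m compm1; reflexivity.
- move=> i j k h h' h''; apply: ei.
  rewrite -compA dmP compA dmP -compA (dmapM D h h' h'') dmP; reflexivity.
split=> // i j h.
have [k [l [r [e [t [cle mt et]]]]]] := fact i j (q j \oc dmap D h).
have zj : zker z (dmap D h \oc (dmap D (le0 i) \oc j0)) (q j).
  apply: kc_ker H _ _ _ _ _ _; apply: conf_heq H _ _ _ _ _ _ _ _ _ (cf j).
    by rewrite lD; reflexivity.
  by reflexivity.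
apply: (quotient_mono (kc_cok H (cf i)) (mD _ _ h) zj (dmP i j h) (kc_cok H cle) mt).
by rewrite dmP et; reflexivity.
Qed.

End Presentations.

(** * Quotients of ind-objects by objects of the base category *)

Section LevelHom.
Variables (C : category) (I : preord) (dI : directed I) (S T R V : diagram C I)
 (f : forall n, hom (S n) (T n)) (g : forall n, hom (T n) (R n))
 (f' : forall n, hom (S n) (V n)) (g' : forall n, hom (V n) (R n))
 (nf : forall n m (h : ple n m), dmap T h \oc f n =~ f m \oc dmap S h)
 (ng : forall n m (h : ple n m), dmap R h \oc g n =~ g m \oc dmap T h)
 (nf' : forall n m (h : ple n m), dmap V h \oc f' n =~ f' m \oc dmap S h)
 (ng' : forall n m (h : ple n m), dmap R h \oc g' n =~ g' m \oc dmap V h).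

Lemma level_square : (forall n, g n \oc f n =~ g' n \oc f' n) ->
  level_hom dI ng \oc level_hom dI nf =~ level_hom dI ng' \oc level_hom dI nf'.
Proof. by move=> e n; apply: (germ_eqE (Y := IndOb dI R)); exact: e. Qed.

Lemma level_of_germ a n (w : hom a (S n)) :
  level_hom dI nf \oc of_germ (mkgerm (Y := IndOb dI S) w) =~
  of_germ (mkgerm (Y := IndOb dI T) (f n \oc w)).
Proof. by rewrite comp_of_germ; reflexivity. Qed.
End LevelHom.

Lemma of_germ_mk (C : category) (Y : Ind C) a j (f g : hom a (ind_diag Y j)) :
  f =~ g -> of_germ (mkgerm f) =~ of_germ (mkgerm g).
Proof. by move=> e; apply: of_germ_eq; exact: germ_eqE. Qed.

Section Core.
Variables (C : ccat) (z : zeros C) (H : abelian z).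

Lemma mono_id (a : C) : mono (idm a).
Proof. by move=> t h k; rewrite !comp1m. Qed.

(** The image r of an object a of the base category in the middle of a
    conflation S -> T -> R of ind-objects, its trace c on S and its image d in R
    again lie in the base category, and the quotients by c, r and d form a
    conflation.  The image of a is computed at the first term where phi is
    represented and does not change afterwards, because the transitions are
    monomorphisms. *)
Lemma ind_const_3x3 (S T R : Ind C) (s : hom S T) (p : hom T R) a
    (phi : hom (ind_const a) T) : ind_conf s p ->
  exists (W K N : Ind C) (c r d : C) (cr : hom c r) (rd : hom r d)
    (jS : hom (ind_const c) S) (jT : hom (ind_const r) T)
    (jR : hom (ind_const d) R) (qS : hom S W) (qT : hom T K) (qR : hom R N)
    (w : hom W K) (n : hom K N) (e : hom a r),
  [/\ conf cr rd, ind_conf jS qS, ind_conf jT qT & ind_conf jR qR] /\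
  [/\ ind_conf w n, adm_epi e & phi =~ jT \oc ind_const_hom e] /\
  [/\ s \oc jS =~ jT \oc ind_const_hom cr, p \oc jT =~ jR \oc ind_const_hom rd,
      w \oc qS =~ qT \oc s & n \oc qT =~ qR \oc p] /\
  [/\ inda_ob W, inda_ob K & inda_ob N].
Proof.
move=> /(conf_presentation phi) [I [dI [cI [n0 [le0 [S' [T' [R' [s' [p' [ns [np [al [be [ga [u0]]]]]]]]]]]]]]]].
move=> [[oS oT oR csp] [[[al' [a1 a2]] [be' [b1 b2]] [ga' [g1 g2]]] [es ep ephi]]].
have mS := inda_mono H oS; have mT := inda_mono H oT; have mR := inda_mono H oR.
have [r [e [j0 [ee mj ej]]]] := ab_fact H u0.
have [d [rd [jd [erd mjd ejd]]]] := ab_fact H (p' n0 \oc j0).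
have [c [cr hcd]] := ab_epi H erd.
have [crd mcr _] := kc_ker H hcd.
have [js ejs] : exists js, s' n0 \oc js =~ j0 \oc cr.
  have [_ _ l] := kc_ker H (csp n0); apply: l.
  by rewrite compA ejd -compA crd z0l; reflexivity.
pose JS n := dmap S' (le0 n) \oc js.
pose JT n := dmap T' (le0 n) \oc j0.
pose JR n := dmap R' (le0 n) \oc jd.
have mJT n : mono (JT n) by apply: mono_comp mj _; exact: mT.
have mJR n : mono (JR n) by apply: mono_comp mjd _; exact: mR.
have e1 n : s' n \oc JS n =~ JT n \oc cr.
  by rewrite /JS /JT compA -ns -compA ejs compA; reflexivity.
have e2 n : p' n \oc JT n =~ JR n \oc rd.
  by rewrite /JR /JT compA -np -compA ejd compA; reflexivity.
(* the 3x3 lemma at each term, with the constant row c -> r -> d on top *)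
have {}cols n := quotient_conf H (csp n) hcd (mJT n) (mJR n) (e1 n) (e2 n).
move: cols => /dep_choice [W /dep_choice [K /dep_choice [N]]].
move=> /dep_choice [qS /dep_choice [qT /dep_choice [qR]]].
move=> /dep_choice [w /dep_choice [n hn]].
have cS i : conf (JS i) (qS i) by have [[]] := hn i.
have cT i : conf (JT i) (qT i) by have [[]] := hn i.
have cR i : conf (JR i) (qR i) by have [[]] := hn i.
have cwn i : conf (w i) (n i) by have [[]] := hn i.
have ew i : w i \oc qS i =~ qT i \oc s' i by have [_ []] := hn i.
have en i : n i \oc qT i =~ qR i \oc p' i by have [_ []] := hn i.
have fact D E (i i' : I) (psi : @hom C (D i) (E i')) := ab_cokernel H psi.
have [dW [lW [lMW [nW mW]]]] := quotient_system H mS cS (fact S' W).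
have [dK [lK [lMK [nK mK]]]] := quotient_system H mT cT (fact T' K).
have [dN [lN [lMN [nN mN]]]] := quotient_system H mR cR (fact R' N).
pose DW := Diagram lW lMW; pose DK := Diagram lK lMK; pose DN := Diagram lN lMN.
have obs (D : diagram C I) : mono_trans D -> @inda_ob C (IndOb dI D).
  by move=> mD; split=> // i j h; apply: (ab_mono H); exact: mD.
have oW : @inda_ob C (IndOb dI DW) by apply: obs => i j h; exact: mW.
have oK : @inda_ob C (IndOb dI DK) by apply: obs => i j h; exact: mK.
have oN : @inda_ob C (IndOb dI DN) by apply: obs => i j h; exact: mN.
have nw i j (h : ple i j) : dmap DK h \oc w i =~ w j \oc dmap DW h.
  have [_ eq _] := kc_cok H (cS i); apply: eq.
  rewrite -compA ew /= compA nK -(compA (qT j)) ns compA -ew -!compA nW; reflexivity.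
have nn i j (h : ple i j) : dmap DN h \oc n i =~ n j \oc dmap DK h.
  have [_ eq _] := kc_cok H (cT i); apply: eq.
  rewrite -compA en /= compA nN -(compA (qR j)) np compA -en -!compA nK; reflexivity.
exists (IndOb dI DW), (IndOb dI DK), (IndOb dI DN), c, r, d, cr, rd.
exists (al \oc of_germ (mkgerm (Y := IndOb dI S') js)).
exists (be \oc of_germ (mkgerm (Y := IndOb dI T') j0)).
exists (ga \oc of_germ (mkgerm (Y := IndOb dI R') jd)).
exists (level_hom dI (T := DW) nW \oc al'), (level_hom dI (T := DK) nK \oc be').
exists (level_hom dI (T := DN) nN \oc ga').
exists (@level_hom C I dI DW DK w nw), (@level_hom C I dI DK DN n nn), e.
have cc (D E : diagram C I) q nq X (f : @hom (Ind C) (IndOb dI D) X) f' b (j : hom b (D n0)) :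
    @inda_ob C (IndOb dI D) -> @inda_ob C (IndOb dI E) ->
    (forall n, conf (dmap D (le0 n) \oc j) (q n)) ->
    f' \oc f =~ idm (IndOb dI D : Ind C) -> f \oc f' =~ idm X ->
    ind_conf (f \oc of_germ (mkgerm (Y := IndOb dI D) j)) (@level_hom C I dI D E q nq \oc f').
  move=> oD oE cq f1 f2; apply: const_conf cq _ _ => //.
  - by apply: (ab_mono H); exact: mono_id.
  - by exists f'.
  - by rewrite -compA f1 compm1; reflexivity.
split; first by split=> //; apply: cc.
split.
  split; last 2 first.
  - exact: (ab_epi H).
  - rewrite ephi -compA of_germ_const; apply: comp_heq; first by reflexivity.
    exact: (of_germ_mk (Y := IndOb dI T')).
  exists I, dI, DW, DK, DN, w, n, nw, nn; split=> //; split=> //.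
  by apply: iso_seq_heq; reflexivity.
split=> //; split.
- rewrite compA es -!compA level_of_germ of_germ_const.
  by apply: comp_heq; [reflexivity | exact: (of_germ_mk (Y := IndOb dI T'))].
- rewrite compA ep -!compA level_of_germ of_germ_const.
  by apply: comp_heq; [reflexivity | exact: (of_germ_mk (Y := IndOb dI R'))].
- have bs : be' \oc s =~ level_hom dI ns \oc al'.
    by rewrite -(compm1 (be' \oc s)) -a2 -compA (compA s) es !compA b1 comp1m; reflexivity.
  rewrite -compA bs !compA; apply: comp_heq; last by reflexivity.
  exact: level_square.
- have bs : ga' \oc p =~ level_hom dI np \oc be'.
    by rewrite -(compm1 (ga' \oc p)) -b2 -compA (compA p) ep !compA g1 comp1m; reflexivity.
  rewrite -compA bs !compA; apply: comp_heq; last by reflexivity.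
  exact: level_square.
Qed.

End Core.

(** * Partially abelian exact categories are abelian *)

Section ExactAbelian.
Variable A : exact_category.
Let M := exact_add A.
Local Notation "f +m g" := (addm M f g) (at level 56, left associativity).
Local Notation zero := (zerom M).

#[local] Instance addm_proper (a b : A) : Proper (heq ==> heq ==> heq) (@addm A M a b).
Proof. by move=> f f' ef g g' eg; exact: addm_heq. Qed.

Lemma addm0 (a b : A) (f : hom a b) : f +m zero a b =~ f.
Proof. by rewrite addmC add0m; reflexivity. Qed.

Lemma addm_idem (a b : A) (x : hom a b) : x =~ x +m x -> x =~ zero a b.
Proof.
move=> e; rewrite -(add0m M x) -(addNm M x) -addmA -e; reflexivity.
Qed.

Definition zeros_exact : zeros A.
Proof.
refine (@Zeros A (zerom M) _ _) => a b c f; apply: addm_idem.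
- by rewrite -compmD add0m; reflexivity.
- by rewrite -compDm add0m; reflexivity.
Defined.

(** Uniqueness in the universal property of kernels is the cancellation
    property of monomorphisms. *)
Lemma exact_kc : @kc A zeros_exact.
Proof.
split.
- move=> a b c i p h; have [e u] := conf_kernel h; split=> //.
  + move=> t h1 h2 eh.
    have [|k [_ uk]] := u _ (i \oc h1).
      by rewrite compA e; exact: (z0r zeros_exact).
    rewrite (uk h1); last by reflexivity.
    by rewrite (uk h2) ?eh; reflexivity.
  + by move=> t h1 /u [k [ek _]]; exists k.
- move=> a b c i p h; have [e u] := conf_cokernel h; split=> //.
  + move=> t h1 h2 eh.
    have [|k [_ uk]] := u _ (h1 \oc p).
      by rewrite -compA e; exact: (z0l zeros_exact).
    rewrite (uk h1); last by reflexivity.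
    by rewrite (uk h2) ?eh; reflexivity.
  + by move=> t h1 /u [k [ek _]]; exists k.
- by move=> a b c a' b' c' i p i' p'; exact: conf_iso.
Qed.

(** The inclusion of b in a direct sum is the pushout of k -> b along k -> a,
    where k is a zero object.  A zero object for which k -> a is an admissible
    monomorphism is the kernel of the identity of a. *)
Lemma biproduct_conf (a b s : A) (i1 : hom a s) (i2 : hom b s) (p1 : hom s a) (p2 : hom s b) :
  p1 \oc i1 =~ idm a -> p2 \oc i2 =~ idm b ->
  p2 \oc i1 =~ zero a b -> p1 \oc i2 =~ zero b a ->
  i1 \oc p1 +m i2 \oc p2 =~ idm s -> conf i2 p1.
Proof.
move=> e11 e22 e21 e12 e.
have ck : zcok zeros_exact i2 p1.
  split=> //.
  - move=> t h k eh; rewrite -(compm1 h) -(compm1 k) -e11 !compA eh; reflexivity.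
  - move=> t h eh; exists (h \oc i1).
    rewrite -{2}(compm1 h) -e compmD !compA eh -[X in _ =~ _ +m X]/(z0 zeros_exact b t \oc p2) z0r.
    by rewrite addm0; reflexivity.
apply: (zcok_conf exact_kc ck).
have [k [o ho]] := adm_epi1 a.
have o0 : o =~ zero k a by have [eo _ _] := kc_ker exact_kc ho; rewrite -(comp1m o).
have am : adm_mono o by exists a, (idm a).
have [d [j1 [j2 [[ej uj] [c [r hr]]]]]] := adm_mono_pushout (zero k b) am.
(* compare the pushout d with the direct sum s *)
have [|v [[v1 v2] uv]] := uj _ i1 i2.
  by rewrite o0 (z0l zeros_exact) (z0l zeros_exact); reflexivity.
pose w := j1 \oc p1 +m j2 \oc p2.
have w1 : w \oc i1 =~ j1.
  rewrite /w compDm -!compA e11 e21 compm1 (z0l zeros_exact) /= addm0; reflexivity.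
have w2 : w \oc i2 =~ j2.
  rewrite /w compDm -!compA e22 e12 compm1 (z0l zeros_exact) /= add0m; reflexivity.
have vw : v \oc w =~ idm s.
  by rewrite /w compmD !compA v1 v2 e; reflexivity.
have wv : w \oc v =~ idm d.
  have [|x [_ ux]] := uj _ j1 j2 => //.
  rewrite (ux (w \oc v)); last by rewrite -!compA v1 v2 w1 w2; split; reflexivity.
  by symmetry; apply: ux; rewrite !comp1m; split; reflexivity.
exists c, (r \oc w); apply: (conf_mid_iso exact_kc (t := v)) hr.
- by exists w.
- by rewrite v2; reflexivity.
- by rewrite -compA wv compm1; reflexivity.
Qed.

(** The graph of f is the image of the inclusion i1 under the automorphism
    1 + i2 f p1 of the direct sum, so it is an admissible monomorphism. *)
Lemma graph_fact (a b : A) (f : hom a b) :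
  exists (s : A) (i : hom a s) (p : hom s b),
    [/\ adm_mono i, adm_epi p & f =~ p \oc i].
Proof.
have [s [i1 [i2 [p1 [p2 [e11 e22 e21 e12 e]]]]]] := biproducts M a b.
have c1 : conf i1 p2.
  by apply: (biproduct_conf (i1 := i2) (p2 := p1)) => //; rewrite addmC.
exists s, (i1 +m i2 \oc f), p2; split; last 1 first.
- by rewrite compmD e21 compA e22 comp1m add0m; reflexivity.
- have inv (h k : hom a b) : h +m k =~ zero a b ->
     (idm s +m i2 \oc h \oc p1) \oc (idm s +m i2 \oc k \oc p1) =~ idm s.
    move=> hk; rewrite compmD compDm comp1m compm1 !compDm comp1m.
    rewrite !compA -(compA _ p1 i2) e12 (z0l zeros_exact) !(z0r zeros_exact) /= addm0.
    rewrite -addmA -compDm -compmD hk (z0l zeros_exact) (z0r zeros_exact) addm0.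
    by reflexivity.
  pose t := idm s +m i2 \oc f \oc p1; pose t' := idm s +m i2 \oc oppm M f \oc p1.
  have tt' : t \oc t' =~ idm s by apply: inv; rewrite addmC addNm; reflexivity.
  have t't : t' \oc t =~ idm s by apply: inv; rewrite addNm; reflexivity.
  exists b, (p2 \oc t'); apply: (conf_mid_iso exact_kc (t := t)) c1.
  + by exists t'.
  + by rewrite /t compDm comp1m -compA e11 compm1; reflexivity.
  + by rewrite -compA t't compm1; reflexivity.
- by exists a, i1.
Qed.

(** Applied to the graph of f and the projection, the hypothesis gives an
    admissible epimorphism q and an admissible monomorphism j with f = j q.  If f
    is mono then q is, so q, the cokernel of a zero arrow, is an isomorphism;
    dually for j. *)
Lemma partially_abelian_abelian : partially_abelian A -> @abelian A zeros_exact.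
Proof.
move=> hA.
have fact (a b : A) (f : hom a b) : exists c (q : hom a c) (j : hom c b),
    [/\ adm_epi q, adm_mono j & f =~ j \oc q].
  have [s [i [p [hi hp e]]]] := graph_fact f.
  have [d [q [j [[hq hj e'] _]]]] := hA _ _ _ _ _ hi hp.
  by exists d, q, j; split=> //; rewrite e.
have zid (a : A) : zker zeros_exact (idm a) (zero a a) /\ zcok zeros_exact (zero a a) (idm a).
  split; split=> //; rewrite ?comp1m ?compm1 /=.
  - by reflexivity.
  - exact: mono_id.
  - by move=> t h _; exists h; rewrite comp1m; reflexivity.
  - by reflexivity.
  - by move=> t h k; rewrite !compm1.
  - by move=> t h _; exists h; rewrite compm1; reflexivity.
have K := exact_kc.
have epi_of (a b : A) (q : hom a b) : adm_epi q -> epi q.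
  by move=> [k [i /(kc_cok K) []]].
split=> //.
- move=> a b f; have [c [q [j [hq hj e]]]] := fact _ _ f.
  by exists c, q, j; split=> //; [exact: epi_of | exact: adm_mono_mono K _ _ _ hj].
- move=> a b f mf; have [c [q [j [[k [l hq]] [r [p hj]] e]]]] := fact _ _ f.
  have [_ mj _] := kc_ker K hj; have [ql ml dl] := kc_ker K hq.
  have l0 : l =~ zero k a.
    apply: (@mono_z0 _ zeros_exact _ _ _ f) mf _.
    by rewrite e -compA ql; exact: (z0l zeros_exact).
  have [g [gq qg]] : is_iso q.
    have [_ eq dq] := kc_cok K hq; have [|g eg] := dq _ (idm a).
      by rewrite comp1m.
    exists g; split=> //; apply: eq; rewrite -compA eg comp1m compm1; reflexivity.
  exists r, p; apply: (conf_ker_iso K (t := q)) hj; first by exists g.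
  by rewrite e; reflexivity.
- move=> a b f ef; have [c [q [j [[k [l hq]] [r [p hj]] e]]]] := fact _ _ f.
  have [pj mj dj] := kc_ker K hj; have [_ eq _] := kc_cok K hq.
  have p0 : p =~ zero b r.
    by apply: ef; rewrite e compA pj !(z0r zeros_exact); reflexivity.
  have ij : is_iso j.
    have [|g eg] := dj _ (idm b); first by rewrite compm1.
    exists g; split=> //; apply: mj; rewrite compA eg comp1m compm1; reflexivity.
  exists k, l; apply: (conf_cok_iso K ij) hq.
  by rewrite e; reflexivity.
Qed.

End ExactAbelian.

(** * Pro-objects of a partially abelian category *)

Section IndConst.
Variables (C : ccat) (z : zeros C) (H : abelian z).

Lemma ind_const_inda (a : C) : adm_mono (idm a) -> @inda_ob C (ind_const a).
Proof. by move=> h; split=> [|i j le]; first by exists (fun=> 0) => -[] []. Qed.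

Lemma ind_const_conf (a b c : C) (i : hom a b) (p : hom b c) :
  conf i p -> ind_conf (ind_const_hom i) (ind_const_hom p).
Proof.
move=> h.
have ob (x : C) : @inda_ob C (ind_const x).
  by apply: ind_const_inda; apply: (ab_mono H); exact: mono_id.
have nt (x y : C) (f : hom x y) (n m : unit_preord) (l : ple n m) :
    dmap (ind_diag (ind_const y)) l \oc f =~ f \oc dmap (ind_diag (ind_const x)) l.
  by rewrite /= comp1m compm1; reflexivity.
exists unit_preord, unit_directed, (ind_diag (ind_const a)), (ind_diag (ind_const b)),
  (ind_diag (ind_const c)), (fun=> i), (fun=> p), (nt _ _ i), (nt _ _ p).
split; first by split; exact: ob.
split=> //; apply: iso_seq_heq; case; exact: reflexivity.
Qed.

(** The zero object is found as the kernel of the identity of some term of X;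
    using one zero object o for all terms makes the system constant. *)
Lemma ind_conf_id (X : Ind C) : inda_ob X ->
  exists (W : Ind C) (f : hom W X), inda_ob W /\ ind_conf f (idm X).
Proof.
case: X => I dI D oX; case: (dI.1) => i0.
have eid a : epi (idm a : @hom C a a) by move=> t f g; rewrite !compm1.
have [o [k hk]] := ab_epi H (eid (D i0)).
have [k0 mk _] := kc_ker H hk; rewrite comp1m in k0.
have o_zero t (f g : hom t o) : f =~ g by apply: mk; rewrite !k0 !z0r; reflexivity.
have zk a : conf (z0 z o a) (idm a).
  apply: (zker_conf H); last exact: (ab_epi H).
  split; first by rewrite comp1m; reflexivity.
    by move=> t f g _; exact: o_zero.
  by move=> t f; rewrite comp1m => e; exists (z0 z t o); rewrite z0l e; reflexivity.
have nt n m (h : ple n m) : dmap D h \oc z0 z o (D n) =~ z0 z o (D m) \oc dmap (const_diag I o) h.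
  by rewrite z0l z0r; reflexivity.
have ni n m (h : ple n m) : dmap D h \oc idm (D n) =~ idm (D m) \oc dmap D h.
  by rewrite comp1m compm1; reflexivity.
have oW : @inda_ob C (IndOb dI (const_diag I o)).
  by split=> [|i j h]; [exact: oX.1 | apply: (ab_mono H); exact: mono_id].
exists (IndOb dI (const_diag I o)), 
  (@level_hom C I dI (const_diag I o) D (fun n => z0 z o (D n)) nt); split=> //.
exists I, dI, (const_diag I o), D, D, (fun n => z0 z o (D n)), (fun n => idm (D n)), nt, ni.
split=> //; split=> //; apply: iso_seq_heq; first by reflexivity.
by move=> n; reflexivity.
Qed.

End IndConst.

Section Pro.
Variables (A : exact_category) (hA : partially_abelian A).
Let zA := zeros_exact A.
Let HA : @abelian A zA := partially_abelian_abelian hA.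
Let HopA : @abelian (cop A) (zeros_op zA) := abelian_op HA.

Definition zeros_pro : zeros (Proa A) :=
  @zeros_op (Inda (cop A)) (@zeros_full (Ind (op A)) (zeros_ind (zeros_op zA)) (@inda_ob (cop A))).

Lemma pro_kc : @kc (Proa A) zeros_pro.
Proof. exact: (kc_op (kc_inda (ab_kc HopA))). Qed.

Lemma pro_of_comp (a b c : A) (g : hom b c) (f : hom a b) :
  pro_of_hom (g \oc f) =~ pro_of_hom g \oc pro_of_hom f.
Proof. exact: (@ind_const_comp (op A) c b a f g). Qed.

Lemma pro_of_id (a : A) : pro_of_hom (idm a) =~ idm (pro_of a).
Proof. exact: (@ind_const_id (op A) a). Qed.

Lemma pro_of_heq (a b : A) (f g : hom a b) : f =~ g -> pro_of_hom f =~ pro_of_hom g.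
Proof. exact: (@ind_const_heq (op A) b a f g). Qed.

Lemma pro_of_full (a b : A) (f : hom (pro_of a) (pro_of b)) :
  exists f0 : hom a b, f =~ pro_of_hom f0.
Proof. exact: (@ind_const_full (op A) b a f). Qed.

Lemma pro_of_faithful (a b : A) (f g : hom a b) :
  pro_of_hom f =~ pro_of_hom g -> f =~ g.
Proof. exact: (@ind_const_faithful (op A) b a f g). Qed.

Lemma pro_of_conf (a b c : A) (i : hom a b) (p : hom b c) :
  conf i p -> conf (pro_of_hom i) (pro_of_hom p).
Proof. exact: (@ind_const_conf (cop A) _ HopA c b a p i). Qed.

Lemma pro_of_adm_mono (a b : A) (i : hom a b) :
  adm_mono i -> adm_mono (pro_of_hom i).
Proof. by move=> [c [p h]]; exists (pro_of c), (pro_of_hom p); exact: pro_of_conf. Qed.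

Lemma pro_of_mono (a b : A) (f : hom a b) : mono (pro_of_hom f) -> adm_mono f.
Proof.
move=> m; apply: (ab_mono HA) => t h k e; apply: pro_of_faithful; apply: m.
by rewrite -!pro_of_comp; exact: pro_of_heq.
Qed.

(** Needed for constant systems of pro-objects to be objects of Ind^a. *)
Lemma pro_id_adm (X : Proa A) : adm_mono (idm X).
Proof.
case: X => X oX; have [W [f [oW h]]] := ind_conf_id HopA oX.
by exists (exist _ W oW), f.
Qed.

(** The dual of [ind_const_3x3]: an arrow from T to an object of A has an image r
    in A, the images of S in r and of r/d in turn are in A, and the kernels form
    a conflation.  Rows and columns are read backwards. *)
Lemma pro_const_3x3 (S T R : Proa A) (s : hom S T) (p : hom T R) (a : A)
    (phi : hom T (pro_of a)) : conf s p ->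
  exists (W K N : Proa A) (d r c : A) (dr : hom d r) (rc : hom r c)
    (kS : hom W S) (kT : hom K T) (kR : hom N R)
    (qS : hom S (pro_of d)) (qT : hom T (pro_of r)) (qR : hom R (pro_of c))
    (w : hom W K) (n : hom K N) (j : hom r a),
  [/\ conf dr rc, conf kS qS, conf kT qT & conf kR qR] /\
  [/\ conf w n, adm_mono j & phi =~ pro_of_hom j \oc qT] /\
  [/\ qT \oc s =~ pro_of_hom dr \oc qS, qR \oc p =~ pro_of_hom rc \oc qT,
      kT \oc w =~ s \oc kS & kR \oc n =~ p \oc kT].
Proof.
case: S T R s p phi => [S oS] [T oT] [R oR] s p phi h.
have [N [K [W [c [r [d [rc [dr [qR [qT [qS [kR [kT [kS [n [w [j]]]]]]]]]]]]]]]]] :=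
  @ind_const_3x3 (cop A) _ HopA R T S p s a phi h.
move=> [[h1 h2 h3 h4] [[h5 h6 h7] [[h8 h9 h10 h11] [oN oK oW]]]].
exists (exist _ W oW), (exist _ K oK), (exist _ N oN), d, r, c, dr, rc.
exists kS, kT, kR, qS, qT, qR, w, n, j.
split; first by split; [exact: h1|exact: h4|exact: h3|exact: h2].
split; first by split; [exact: h5|exact: h6|exact: h7].
by split; [exact: h9|exact: h8|exact: h11|exact: h10].
Qed.

(** The conflation needed around T is T -> T -> 0. *)
Lemma pro_fact (T : Proa A) (a : A) (phi : hom T (pro_of a)) :
  exists (K : Proa A) (k : hom K T) (r : A) (e : hom T (pro_of r)) (j : hom r a),
    [/\ conf k e, adm_mono j & phi =~ pro_of_hom j \oc e].
Proof.
have [R [p h]] := pro_id_adm T.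
have [W [K [N [d [r [c [dr [rc [kS [kT [kR [qS [qT [qR [w [n [j]]]]]]]]]]]]]]]]] :=
  pro_const_3x3 phi h.
by move=> [[h1 h2 h3 h4] [[h5 h6 h7] _]]; exists K, kT, r, qT, j.
Qed.

End Pro.

(** * The image of a lattice in a quotient *)

(* From here on pro-objects are used only through the results above. *)
#[local] Opaque Proa.

Section Main.
Variables (A : exact_category) (hA : partially_abelian A).
Let zP := zeros_pro A.
Let HP : @kc (Proa A) zP := pro_kc hA.
Let zE := zeros_ind zP.

(** Monomorphisms between objects of A are admissible in the category of
    pro-objects, although monomorphisms of pro-objects are
    not admissible in general. *)
Lemma pro_mono_adm (a b : A) (f : hom (pro_of a) (pro_of b)) : mono f -> adm_mono f.
Proof.
move=> m; have [f0 e] := pro_of_full f.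
have [c [p h]] := pro_of_adm_mono hA (pro_of_mono hA (mono_heq e m)).
exists c, p; apply: conf_heq HP _ _ _ _ _ _ _ _ _ h; last by reflexivity.
by rewrite e; reflexivity.
Qed.

Lemma pro_of_adm_mono_mono (a b : A) (f : hom a b) : adm_mono f -> mono (pro_of_hom f).
Proof. by move=> h; apply: (adm_mono_mono HP); exact: pro_of_adm_mono. Qed.

(** Objects of A form a full subcategory of the category of pro-objects, so a
    system of pro-objects whose terms are in A comes from an ind-object of A. *)
Lemma diag_of_pro_of (I : preord) (c : I -> A)
    (dm : forall i j, ple i j -> hom (pro_of (c i)) (pro_of (c j))) :
  (forall i (h : ple i i), dm i i h =~ idm (pro_of (c i))) ->
  (forall i j k (h : ple i j) (h' : ple j k) (h'' : ple i k), dm j k h' \oc dm i j h =~ dm i k h'') ->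
  (forall i j h, mono (dm i j h)) ->
  exists (dA : forall i j, ple i j -> hom (c i) (c j))
    (l1 : forall i (h : ple i i), dA i i h =~ idm (c i))
    (lM : forall i j k (h : ple i j) (h' : ple j k) (h'' : ple i k),
       dA j k h' \oc dA i j h =~ dA i k h''),
    forall i j h, dm i j h =~ pro_of_hom (dA i j h) /\ adm_mono (dA i j h).
Proof.
move=> l1 lM mm.
have /dep_choice [dA] := fun i => dep_choice (fun j => dep_choice (fun h => pro_of_full (dm i j h))).
move=> e; unshelve eexists dA, _, _.
- by move=> i h; apply: pro_of_faithful; rewrite -e l1 pro_of_id; reflexivity.
- move=> i j k h h' h''; apply: pro_of_faithful.
  by rewrite pro_of_comp -!e lM; reflexivity.
move=> i j h; split; first exact: e.
by apply: (pro_of_mono hA); exact: mono_heq (e i j h) (mm i j h).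
Qed.

Lemma indpro_mono (B : Inda A) : mono_trans (ind_diag (indpro_of B)).
Proof. by move=> i j h; apply: pro_of_adm_mono_mono; exact: (svalP B).2. Qed.

Section Level.
Variables (I : preord) (n0 : I) (le0 : forall n, ple n0 n) (S T R : diagram (Proa A) I)
  (s : forall n, hom (S n) (T n)) (p : forall n, hom (T n) (R n))
  (nat_s : forall n m (h : ple n m), dmap T h \oc s n =~ s m \oc dmap S h)
  (nat_p : forall n m (h : ple n m), dmap R h \oc p n =~ p m \oc dmap T h)
  (csp : forall n, conf (s n) (p n)) (mR : mono_trans R)
  (P : Proa A) (un : forall n, hom P (T n))
  (nat_u : forall n m (h : ple n m), dmap T h \oc un n =~ un m)
  (b : I -> A) (phi : forall n, hom (T n) (pro_of (b n)))
  (ker : forall n, zker zP (un n) (phi n)).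

(** One term of the system.  The kernel of phi_n produced by [pro_const_3x3] is
    replaced by the given kernel P. *)
Lemma stage_intersection n : exists (W N : Proa A) (d r c : A) (dr : hom d r) (rc : hom r c)
    (kS : hom W (S n)) (kR : hom N (R n)) (qS : hom (S n) (pro_of d))
    (qT : hom (T n) (pro_of r)) (qR : hom (R n) (pro_of c)) (w : hom W P) (q : hom P N),
  [/\ conf dr rc, conf kS qS, conf (un n) qT, conf kR qR & conf w q] /\
  [/\ qT \oc s n =~ pro_of_hom dr \oc qS, qR \oc p n =~ pro_of_hom rc \oc qT,
      un n \oc w =~ s n \oc kS & kR \oc q =~ p n \oc un n].
Proof.
have [W [K [N [d [r [c [dr [rc [kS [kT [kR [qS [qT [qR [w [q [j]]]]]]]]]]]]]]]]] :=
  pro_const_3x3 hA (phi n) (csp n).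
move=> [[h1 h2 h3 h4] [[h5 h6 h7] [h8 h9 h10 h11]]].
have [fu _ _] := ker n; have [qk _ _] := kc_ker HP h3.
have [t [it et]] : exists t : hom P K, is_iso t /\ kT \oc t =~ un n.
  apply: (zker_uniq (ker n) (kc_ker HP h3)).
    by rewrite h7 -compA qk z0l; reflexivity.
  apply: (mono_z0 (pro_of_adm_mono_mono h6)).
  by rewrite compA -h7.
have [t' [t't tt']] := it.
exists W, N, d, r, c, dr, rc, kS, kR, qS, qT, qR, (t' \oc w), (q \oc t).
split; split.
- exact: h1.
- exact: h2.
- exact: conf_ker_iso HP _ _ _ _ _ _ _ _ it et h3.
- exact: h4.
- apply: (conf_mid_iso HP (t := t')) h5; first by exists t.
    by reflexivity.
  by rewrite -compA tt' compm1; reflexivity.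
- exact: h8.
- exact: h9.
- by rewrite -et compA -(compA kT) tt' compm1 h10; reflexivity.
- by rewrite compA h11 -compA et; reflexivity.
Qed.

(** The subobject W_n of P is the kernel of P -> T_n -> R_n.  As R_n0 -> R_n is
    mono, this is the same for all n; hence so is the quotient N_n of P. *)
Lemma stage_comparison : exists (W N : Proa A) (w : hom W P) (q : hom P N)
    (x0 : hom W (S n0)) (m0 : hom N (R n0)),
  [/\ conf w q, un n0 \oc w =~ s n0 \oc x0 & m0 \oc q =~ p n0 \oc un n0] /\
  forall n, exists (d r c : A) (dr : hom d r) (rc : hom r c)
    (qS : hom (S n) (pro_of d)) (qT : hom (T n) (pro_of r)) (qR : hom (R n) (pro_of c)),
  [/\ conf dr rc, conf (dmap S (le0 n) \oc x0) qS, conf (un n) qT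
    & conf (dmap R (le0 n) \oc m0) qR] /\
  qT \oc s n =~ pro_of_hom dr \oc qS /\ qR \oc p n =~ pro_of_hom rc \oc qT.
Proof.
have [W0 [N0 [? [? [? [? [? [x0 [m0 [? [? [? [w0 [q0]]]]]]]]]]]]]] := stage_intersection n0.
move=> [[_ _ _ cm0 cw0] [_ _ ew0 em0]].
exists W0, N0, w0, q0, x0, m0; split; [by split|move=> n].
have [W [N [d [r [c [dr [rc [kS [kR [qS [qT [qR [w [q]]]]]]]]]]]]]] := stage_intersection n.
move=> [[h1 h2 h3 h4 h5] [e1 e2 e3 e4]].
exists d, r, c, dr, rc, qS, qT, qR; split; last by split; [exact: e1|exact: e2].
have [wq0 mw0 _] := kc_ker HP cw0; have [_ eq0 _] := kc_cok HP cw0.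
have [_ mkR _] := kc_ker HP h4; have [_ mm0 _] := kc_ker HP cm0.
have [ps ms _] := kc_ker HP (csp n).
have eR : dmap R (le0 n) \oc m0 \oc q0 =~ p n \oc un n.
  by rewrite -compA em0 compA nat_p -compA nat_u; reflexivity.
(* W0 and W are both killed by P -> R_n *)
have qw0 : q \oc w0 =~ z0 zP _ _.
  apply: (mono_z0 mkR); rewrite compA e4 -eR -compA wq0 z0l; reflexivity.
have q0w : q0 \oc w =~ z0 zP _ _.
  have mm := mono_comp mm0 (@mR n0 n (le0 n)); apply: (mono_z0 mm).
  by rewrite compA eR -compA e3 compA ps z0r; reflexivity.
have [t [it et]] := zker_uniq (kc_ker HP cw0) (kc_ker HP h5) q0w qw0.
have [th [ith eth]] := zcok_uniq (kc_cok HP cw0) (kc_cok HP h5) q0w qw0.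
split; [exact: h1 | | exact: h3 | ].
- apply: (conf_ker_iso HP it _ h2); apply: ms.
  by rewrite compA -e3 -compA et compA -nat_s -compA -ew0 compA nat_u; reflexivity.
- apply: (conf_ker_iso HP ith _ h4); apply: eq0.
  by rewrite -compA eth e4 eR; reflexivity.
Qed.

End Level.

(** The theorem for a subobject P of Y in Pro^a(A) that is the kernel of an
    arrow v to an object of Ind^a(A). *)
Lemma lattice_image (X Y Z : Ind (Proa A)) (f : hom X Y) (g : hom Y Z) (P : Proa A)
    (u : hom (ind_const P) Y) (B : Inda A) (v : hom Y (indpro_of B)) :
  ind_conf f g -> zker zE u v ->
  exists (W N : Proa A) (D : Inda A) (w : hom W P) (q : hom P N)
    (x : hom (ind_const W) X) (m : hom (ind_const N) Z) (pm : hom Z (indpro_of D)),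
  [/\ conf w q, is_pullback f u x (ind_const_hom w), mono x
    & g \oc u =~ m \oc ind_const_hom q] /\
  ind_conf m pm.
Proof.
move=> hfg [vu mu lu].
have [I [dI [cI [n0 [le0 [S [T [R [s [p [ns [np [al [be [ga [u0]]]]]]]]]]]]]]]] :=
  conf_presentation u hfg.
move=> [[oS oT oR csp] [[ial ibe iga] [es ep eu]]].
have mS := inda_mono HP oS; have mT := inda_mono HP oT; have mR := inda_mono HP oR.
pose un n := dmap T (le0 n) \oc u0.
have un0 : un n0 =~ u0 by rewrite /un dmap1 comp1m; reflexivity.
have nu n m (h : ple n m) : dmap T h \oc un n =~ un m.
  by rewrite /un compA (dmapM T _ _ (le0 m)); reflexivity.
pose G a n (t : hom a (T n)) : hom (ind_const a) (IndOb dI T) :=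
  of_germ (mkgerm (Y := IndOb dI T) t).
have Gn a n m (h : ple n m) (t : hom a (T n)) : G a n t =~ G a m (dmap T h \oc t).
  by apply: of_germ_eq; exact: (germ_eq_map (Y := IndOb dI T)).
have Ginj a n (t t' : hom a (T n)) : G a n t =~ G a n t' -> t =~ t'.
  by move=> /(_ tt); exact: (germ_inj (Y := IndOb dI T)).
pose vb : @hom (Ind (Proa A)) (IndOb dI T) (indpro_of B) := v \oc be.
(* the arrow T_n -> Y/U lands in one term of the ind-object B *)
pose phi n : hom (T n) (pro_of (sval B (tag (icomp vb n)))) := tagged (icomp vb n).
have vbG a n (t : hom a (T n)) : vb \oc G a n t =~ of_germ (mkgerm (Y := indpro_of B) (phi n \oc t)).
  by rewrite comp_of_germ; reflexivity.
(* P is the kernel of T_n -> Y -> Y/U: an arrow to T_n killed by phi_n factors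
   through u in the colimit, hence in T_n *)
have ker n : zker zP (un n) (phi n).
  have euG : u =~ be \oc G P n (un n).
    rewrite eu; apply: comp_heq; first by reflexivity.
    exact: (Gn _ _ _ (le0 n) u0).
  split.
  - have : vb \oc G P n (un n) =~ z0 zE _ _ by rewrite -compA -euG.
    rewrite vbG => /(_ tt); exact: (germ0_inj (@indpro_mono B)).
  - move=> t h k e; apply: ind_const_faithful; apply: mu.
    rewrite euG -!compA !of_germ_const; apply: comp_heq; first by reflexivity.
    exact: (of_germ_mk (Y := IndOb dI T)).
  - move=> t h e; have [|k ek] := lu _ (be \oc G t n h).
      rewrite compA vbG; case; apply: germ0E; exact: e.
    have [l el] := ind_const_full k; exists l; apply: Ginj; apply: (iso_mono ibe).
    by rewrite -ek el euG -compA of_germ_const; reflexivity.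
have [W [N [w [q [x0 [m0 [[cwq ex0 em0] /dep_choice [d /dep_choice [r /dep_choice [c]]]]]]]]]] :=
  stage_comparison le0 ns np csp mR nu ker.
move=> /dep_choice [dr /dep_choice [rc /dep_choice [qS /dep_choice [qT /dep_choice [qR hn]]]]].
have cdr n : conf (dr n) (rc n) by have [[]] := hn n.
have cS n : conf (dmap S (le0 n) \oc x0) (qS n) by have [[]] := hn n.
have cT n : conf (dmap T (le0 n) \oc u0) (qT n) by have [[]] := hn n.
have cR n : conf (dmap R (le0 n) \oc m0) (qR n) by have [[]] := hn n.
have e1 n : qT n \oc s n =~ pro_of_hom (dr n) \oc qS n by have [_ []] := hn n.
have e2 n : qR n \oc p n =~ pro_of_hom (rc n) \oc qT n by have [_ []] := hn n.
have fact (D : diagram (Proa A) I) (E : I -> A) i i' (psi : hom (D i) (pro_of (E i'))) :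
    exists k (l : hom k (D i)) a (e : hom (D i) a) (j : hom a (pro_of (E i'))),
     [/\ conf l e, mono j & psi =~ j \oc e].
  have [K [k [a [e [j [h1 h2 h3]]]]]] := pro_fact hA psi.
  by exists K, k, (pro_of a), e, (pro_of_hom j); split=> //; exact: pro_of_adm_mono_mono.
have [dS [lS [lMS [nS mdS]]]] := quotient_system HP mS cS (fact S d).
have [dT [lT [lMT [nT mdT]]]] := quotient_system HP mT cT (fact T r).
have [dR [lR [lMR [nR mdR]]]] := quotient_system HP mR cR (fact R c).
have [dA [lA [lMA hdA]]] := diag_of_pro_of lR lMR mdR.
pose DS := Diagram lS lMS; pose DT := Diagram lT lMT.
have oA : @inda_ob A (IndOb dI (Diagram lA lMA)).
  by split=> // i j h; have [] := hdA i j h.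
pose Dc : Inda A := exist _ (IndOb dI (Diagram lA lMA)) oA.
pose DR : diagram (Proa A) I := ind_diag (indpro_of Dc).
have oDR : @inda_ob (Proa A) (IndOb dI DR).
  by split=> // i j h; apply: pro_of_adm_mono => //; have [] := hdA i j h.
have oDS : @inda_ob (Proa A) (IndOb dI DS).
  by split=> // i j h; apply: pro_mono_adm; exact: mdS.
have oDT : @inda_ob (Proa A) (IndOb dI DT).
  by split=> // i j h; apply: pro_mono_adm; exact: mdT.
have nR' i j (h : ple i j) : dmap DR h \oc qR i =~ qR j \oc dmap R h.
  by have [e _] := hdA i j h; rewrite -nR e; reflexivity.
have ndr i j (h : ple i j) : dmap DT h \oc pro_of_hom (dr i) =~ pro_of_hom (dr j) \oc dmap DS h.
  have [_ eq _] := kc_cok HP (cS i); apply: eq.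
  by rewrite -compA -e1 compA /= nT -!compA nS ns !compA e1; reflexivity.
have nrc i j (h : ple i j) : dmap DR h \oc pro_of_hom (rc i) =~ pro_of_hom (rc j) \oc dmap DT h.
  have [_ eq _] := kc_cok HP (cT i); apply: eq.
  by rewrite -compA -e2 compA nR' -!compA nT np !compA e2; reflexivity.
have {}ex0 : s n0 \oc x0 =~ u0 \oc w.
  rewrite -ex0; apply: comp_heq; [exact: un0 | by reflexivity].
have {}em0 : p n0 \oc u0 =~ m0 \oc q.
  rewrite em0; apply: comp_heq; [by reflexivity | symmetry; exact: un0].
have [al' [a1 a2]] := ial; have [be' [b1 b2]] := ibe; have [ga' [g1 g2]] := iga.
pose QS : hom X (IndOb dI DS : Ind (Proa A)) := @level_hom _ I dI S DS qS nS \oc al'.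
pose QT : hom Y (IndOb dI DT : Ind (Proa A)) := @level_hom _ I dI T DT qT nT \oc be'.
pose QR : hom Z (indpro_of Dc) := @level_hom _ I dI R DR qR nR' \oc ga'.
have kx : ind_conf (al \oc of_germ (mkgerm (Y := IndOb dI S) x0)) QS.
  apply: (const_conf oS oDS (pro_id_adm hA W) cS ial).
  by rewrite -compA a1 compm1; reflexivity.
have ku : ind_conf (be \oc of_germ (mkgerm (Y := IndOb dI T) u0)) QT.
  apply: (const_conf oT oDT (pro_id_adm hA P) cT ibe).
  by rewrite -compA b1 compm1; reflexivity.
have km : ind_conf (ga \oc of_germ (mkgerm (Y := IndOb dI R) m0)) QR.
  apply: (const_conf oR oDR (pro_id_adm hA N) cR iga).
  by rewrite -compA g1 compm1; reflexivity.
exists W, N, Dc, w, q, (al \oc of_germ (mkgerm (Y := IndOb dI S) x0)).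
exists (ga \oc of_germ (mkgerm (Y := IndOb dI R) m0)), QR.
have zx := ind_conf_zker HP kx.
split; last exact: km.
split; first exact: cwq; last 2 first.
- by have [] := zx.
- rewrite eu compA ep -!compA level_of_germ of_germ_const; apply: comp_heq; first by reflexivity.
  by apply: (of_germ_mk (Y := IndOb dI R)); exact: em0.
have zu : zker zE u QT.
  by apply: zker_iso_seq (iso_seq_heq _ _) (ind_conf_zker HP ku); [rewrite eu|]; reflexivity.
(* colim d -> colim r is a kernel, hence a monomorphism *)
have zd : zker zE (@level_hom _ I dI DS DT _ ndr) (@level_hom _ I dI DT DR _ nrc).
  apply: level_zker; last exact: (inda_mono HP oDR).
  by move=> n; apply: (kc_ker HP); exact: pro_of_conf.
have [_ md _] := zd.
apply: (kernel_pullback zu zx md).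
- have bs : be' \oc f =~ level_hom dI ns \oc al'.
    by rewrite -(compm1 (be' \oc f)) -a2 -compA (compA f) es !compA b1 comp1m; reflexivity.
  rewrite /QT /QS -compA bs !compA; apply: comp_heq; last by reflexivity.
  exact: level_square.
- rewrite eu compA es -!compA level_of_germ of_germ_const; apply: comp_heq; first by reflexivity.
  by apply: (of_germ_mk (Y := IndOb dI T)); exact: ex0.
Qed.

End Main.

(** * Beilinson systems constant in one direction *)

(* Rows of double systems are handled as ind-objects of A^op. *)
#[local] Transparent Proa.

(** Enumerate I, and at each step choose an upper bound of the previous term and
    of the next element of I. *)
Lemma cofinal_seq (I : preord) : directed I -> countable_index I ->
  exists s : nat -> I, (forall n m, n <= m -> ple (s n) (s m)) /\
    forall i, exists n, ple i (s n).
Proof.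
move=> [[i0] dI] [f fi].
have step (nx : nat * I) : exists y, ple nx.2 y /\ forall i, f i = nx.1 -> ple i y.
  have [[i ei]|no] := classic (exists i, f i = nx.1); last first.
    by exists nx.2; split=> [|i ei]; [exact: ple_refl | case: no; exists i].
  have [y [h1 h2]] := dI nx.2 i; exists y; split=> // i' ei'.
  by rewrite (fi i' i) // ei' ei.
have [nxt hn] := dep_choice step.
pose s := fix s n := if n is m.+1 then nxt (m, s m) else i0.
have sS n : ple (s n) (s n.+1) := (hn (n, s n)).1.
exists s; split=> [n m|i].
  elim: m => [|m IH]; first by rewrite leqn0 => /eqP ->; exact: ple_refl.
  rewrite leq_eqVlt => /orP [/eqP -> |]; first exact: ple_refl.
  by rewrite ltnS => /IH h; exact: ple_trans h (sS m).
by exists (f i).+1; exact: (hn (f i, s (f i))).2.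
Qed.

Lemma dmap_iso (C : category) (I : preord) (D : diagram C I) (i j : I)
  (h : ple i j) (h' : ple j i) : is_iso (dmap D h).
Proof.
by exists (dmap D h'); rewrite !(dmapM D _ _ (ple_refl _)) !dmap1; split; reflexivity.
Qed.

Lemma dmap_idm (C : category) (I : preord) (D : diagram C I) (i j : I)
  (h h' : ple i j) : dmap D h \oc idm _ =~ idm _ \oc dmap D h'.
Proof. by rewrite comp1m compm1; exact: dmap_irr. Qed.

Lemma dmap_idm_refl (C : category) (I : preord) (D : diagram C I) (i j : I)
  (r : ple j j) (h h' : ple i j) : dmap D r \oc (idm _ \oc dmap D h) =~ dmap D h' \oc idm _.
Proof. by rewrite comp1m compm1 dmap1 comp1m; exact: dmap_irr. Qed.

Section PullbackIso.
Variable C : category.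

Lemma iso_pullback (a b c d : C) (f : hom a c) (g : hom b c) (p : hom d a) (q : hom d b) :
  f \oc p =~ g \oc q -> is_iso p -> is_iso g -> is_pullback f g p q.
Proof.
move=> e [p' [p1 p2]] ig; split=> // t h k ehk; exists (p' \oc h); split; last first.
  by move=> u [eu _]; rewrite -eu compA p1 comp1m; reflexivity.
rewrite compA p2 comp1m; split; first by reflexivity.
by apply: (iso_mono ig); rewrite compA -e -compA (compA p) p2 comp1m.
Qed.

Lemma pullback_sym (a b c d : C) (f : hom a c) (g : hom b c) (p : hom d a) (q : hom d b) :
  is_pullback f g p q -> is_pullback g f q p.
Proof.
move=> [e u]; split; first by symmetry.
move=> t h k ehk; have [l [[e1 e2] ul]] := u t k h (symmetry ehk).
by exists l; split=> // l' [e3 e4]; apply: ul.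
Qed.

Lemma pullback_iso (a b b' c d : C) (f : hom a c) (g : hom b c) (g' : hom b' c)
    (p : hom d a) (q : hom d b) (t : hom b b') :
  is_iso t -> g' \oc t =~ g -> is_pullback f g p q -> is_pullback f g' p (t \oc q).
Proof.
move=> [t' [t1 t2]] et [e u]; split; first by rewrite compA et.
move=> x h k ehk; have [|l [[e1 e2] ul]] := u x h (t' \oc k).
  by rewrite -et -compA (compA t) t2 comp1m.
exists l; split; first by split=> //; rewrite -compA e2 compA t2 comp1m; reflexivity.
move=> l' [e3 e4]; apply: ul; split=> //.
by rewrite -e4 !compA t1 comp1m; reflexivity.
Qed.

End PullbackIso.

(** The indices max(-i, 0) and max(j, 0) of the terms used in column i and in
    row j. *)
Definition lower_rank (i : int) : nat := if i is Negz n then n.+1 else 0.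
Definition upper_rank (i : int) : nat := if i is Posz n then n else 0.

Lemma lower_rank_anti (i j : int) : (i <= j)%R -> (lower_rank j <= lower_rank i)%N.
Proof. by case: i j => i [] j; rewrite /lower_rank //; lia. Qed.

Lemma upper_rank_mono (i j : int) : (i <= j)%R -> (upper_rank i <= upper_rank j)%N.
Proof. by case: i j => i [] j; rewrite /upper_rank //; lia. Qed.

Section Constant.
Variables (A : exact_category) (hA : partially_abelian A).
Let HA : @abelian A (zeros_exact A) := partially_abelian_abelian hA.

Lemma iso_adm_mono (a b : A) (f : hom a b) : is_iso f -> adm_mono f.
Proof. by move=> h; apply: (ab_mono HA); exact: iso_mono. Qed.

Lemma iso_adm_epi (a b : A) (f : hom a b) : is_iso f -> adm_epi f.
Proof.
move=> [g [h1 h2]]; apply: (ab_epi HA) => t h k e.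
by rewrite -(compm1 h) -(compm1 k) -h2 !compA e; reflexivity.
Qed.

Section ProSystem.
Variables (I : preord) (D : diagram (op A) I) (s : nat -> I)
  (smon : forall n m, n <= m -> ple (s n) (s m))
  (epiD : forall i j (h : ple i j), @adm_mono (cop A) _ _ (dmap D h)).

Lemma lower_rank_ple (p q : bpair) : ple p q -> ple (s (lower_rank (bfst q))) (s (lower_rank (bfst p))).
Proof. by move=> [h _]; apply/smon/lower_rank_anti. Qed.

Definition pro_bdiag : diagram A bpair.
Proof.
refine (@Diagram A bpair (fun p => D (s (lower_rank (bfst p))))
  (fun p q h => dmap D (lower_rank_ple h)) _ _).
- by move=> i h; exact: (dmap1 D).
- by move=> i j k h h' h''; exact: (dmapM D).
Defined.

Lemma pro_bdiag_iso p q (h : ple p q) : bfst p = bfst q -> is_iso (dmap pro_bdiag h).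
Proof.
move=> e; have h' : ple (s (lower_rank (bfst p))) (s (lower_rank (bfst q))) by rewrite e; exact: ple_refl.
by have [g [h1 h2]] := dmap_iso D (lower_rank_ple h) h'; exists g.
Qed.

(** A pro-object as a double system constant in j: X_(i,j) is the term of index
    max(-i, 0) of a cofinal sequence.  The squares are cartesian because two
    opposite sides are isomorphisms. *)
Definition pro_bsys : beilinson_system A.
Proof.
refine (@BeilinsonSystem A pro_bdiag _ _ _).
- by move=> p q h e; apply: iso_adm_mono; exact: pro_bdiag_iso.
- by move=> p q h e; exact: epiD.
- move=> p q r t pq pr qt rt e1 e2 _ _; apply: iso_pullback.
  + by rewrite !(dmapM pro_bdiag _ _ (ple_trans pq qt)); reflexivity.
  + exact: pro_bdiag_iso.
  + exact: pro_bdiag_iso.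
Defined.

End ProSystem.

Section IndSystem.
Variables (I : preord) (D : diagram A I) (s : nat -> I)
  (smon : forall n m, n <= m -> ple (s n) (s m))
  (monoD : forall i j (h : ple i j), adm_mono (dmap D h)).

Lemma upper_rank_ple (p q : bpair) : ple p q -> ple (s (upper_rank (bsnd p))) (s (upper_rank (bsnd q))).
Proof. by move=> [_ h]; apply/smon/upper_rank_mono. Qed.

Definition ind_bdiag : diagram A bpair.
Proof.
refine (@Diagram A bpair (fun p => D (s (upper_rank (bsnd p))))
  (fun p q h => dmap D (upper_rank_ple h)) _ _).
- by move=> i h; exact: (dmap1 D).
- by move=> i j k h h' h''; exact: (dmapM D).
Defined.

Lemma ind_bdiag_iso p q (h : ple p q) : bsnd p = bsnd q -> is_iso (dmap ind_bdiag h).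
Proof.
move=> e; have h' : ple (s (upper_rank (bsnd q))) (s (upper_rank (bsnd p))) by rewrite e; exact: ple_refl.
exact (@dmap_iso A I D _ _ (upper_rank_ple h) h').
Qed.

(** An ind-object as a double system constant in i: X_(i,j) is the term of index
    max(j, 0) of a cofinal sequence. *)
Definition ind_bsys : beilinson_system A.
Proof.
refine (@BeilinsonSystem A ind_bdiag _ _ _).
- by move=> p q h e; exact: monoD.
- by move=> p q h e; apply: iso_adm_epi; exact: ind_bdiag_iso.
- move=> p q r t pq pr qt rt _ _ e1 e2; apply/pullback_sym/iso_pullback.
  + by rewrite !(dmapM ind_bdiag _ _ (ple_trans pq qt)); reflexivity.
  + exact: ind_bdiag_iso.
  + exact: ind_bdiag_iso.
Defined.

End IndSystem.

(** [reindex] over A^op produces arrows to the rows of the Beilinson system, and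
    [reindex] over the category of pro-objects starts from arrows out of them. *)
Lemma inverse_natural (C : category) (a b a' b' : C) (t : hom a b) (t' : hom a' b')
    (g : hom b a) (g' : hom b' a') (f : hom a a') (k : hom b b') :
  g \oc t =~ idm a -> t' \oc g' =~ idm b' -> f \oc g =~ g' \oc k ->
  k \oc t =~ t' \oc f.
Proof.
move=> e1 e2 e.
by rewrite -(compm1 f) -e1 (compA f) e !compA e2 comp1m; reflexivity.
Qed.

(** Every row of the system is a reindexing of P, compatibly with the arrows
    between rows. *)
Lemma const_beilinson (P : Proa A) : exists X : beilinson_system A,
  @isomorphic (Ind (Proa A)) (ind_const P) (beilinson_of X).
Proof.
case: P => [[I dI D] oD].
pose P : Proa A := exist _ (IndOb dI D) oD; rewrite -[exist _ _ _]/P.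
have [s [smon cof]] := cofinal_seq dI oD.1.
pose X := pro_bsys (D := D) smon (proj2 oD); exists X.
have th j : exists f : @hom (Ind (op A)) (sval (brow_pro X j)) (IndOb dI D),
    is_iso f /\ forall i : brow j,
    icomp f i = @mkgerm (op A) (IndOb dI D) _ (s (lower_rank (sval i))) (@idm (op A) (D (s (lower_rank (sval i))))).
  apply: (@reindex (op A) I (brow j) dI (brow_directed j) D (ind_diag (sval (brow_pro X j)))
    (fun i => s (lower_rank (sval i))) (fun i => @idm (op A) (D (s (lower_rank (sval i)))))).
  - by move=> i; exact: iso_id.
  - move=> i; have [n hn] := cof i.
    have hk : (Num.min (- n%:Z)%R j <= j)%R by exact: bmin_le.
    exists (exist (fun i : int => (i <= j)%R) _ hk) => /=; apply: ple_trans hn _; apply: (smon).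
    have : (Num.min (- n%:Z)%R j <= - n%:Z)%R by rewrite ge_min lexx.
    by move=> /lower_rank_anti; apply: leq_trans; rewrite /lower_rank; case: n {hk}.
  - by move=> i i' h; apply/smon/lower_rank_anti.
  - move=> i i' h h'; exact: (@dmap_idm (op A) I D).
have [f hf] := dep_choice th.
have inv j : exists t : @hom (Proa A) (brow_pro X j) P,
    t \oc (f j : @hom (Proa A) P (brow_pro X j)) =~ idm _ /\
    (f j : @hom (Proa A) P (brow_pro X j)) \oc t =~ idm _.
  by have [[t [h1 h2]] _] := hf j; exists t; split; [exact: h2|exact: h1].
have [t ht] := dep_choice inv.
have nat_f j j' (h : (j <= j')%R) :
    brow_map X h \oc (f j : @hom (Proa A) P (brow_pro X j)) =~ f j'.
  move=> i; have [_ hj] := hf j; have [_ hj'] := hf j'.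
  rewrite /= /germ_post /= hj hj'.
  have le : ple (s (lower_rank (sval i))) (s (lower_rank (Num.min (sval i) j))).
    by apply/smon/lower_rank_anti; rewrite ge_min lexx.
  exists (s (lower_rank (Num.min (sval i) j))), (ple_refl _), le => /=.
  exact: (@dmap_idm_refl (op A) I D).
have iso_sym (C : category) (a b : C) : isomorphic a b -> isomorphic b a.
  by move=> [g [g' [h1 h2]]]; exists g', g.
apply: iso_sym.
have [F [iF _]] : exists F : @hom (Ind (Proa A)) (beilinson_of X) (ind_const P),
    is_iso F /\ forall j : int_preord, icomp F j = mkgerm (Y := ind_const P) (j := tt) (t j).
  apply: (@reindex (Proa A) unit_preord int_preord unit_directed int_directed
    (ind_diag (ind_const P)) (ind_diag (beilinson_of X)) (fun=> tt) t).
  - move=> j; exists (f j); have [h1 h2] := ht j; split; [exact: h2|exact: h1].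
  - by move=> i; exists (0%R : int); case: i.
  - by [].
  - move=> j j' h h'; have [_ h2] := ht j; have [h1' _] := ht j'.
    apply: (inverse_natural h2 h1').
    by rewrite compm1; exact: nat_f.
by exists F.
Qed.

(** The row j of the system is the constant pro-object on one term of the
    ind-object, and these terms are cofinal. *)
Lemma indpro_beilinson (B : Inda A) : exists X : beilinson_system A,
  @isomorphic (Ind (Proa A)) (indpro_of B) (beilinson_of X).
Proof.
case: B => [[I dI D] oD].
have [s [smon cof]] := cofinal_seq dI oD.1.
pose X := ind_bsys (D := D) smon (proj2 oD); exists X.
have th (j : int) : exists f : @hom (Ind (op A)) (sval (brow_pro X j)) (@ind_const (op A) (D (s (upper_rank j)))),
    is_iso f /\ forall i : brow j,
    icomp f i = @mkgerm (op A) (@ind_const (op A) (D (s (upper_rank j)))) _ tt (@idm (op A) (D (s (upper_rank j)))).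
  apply: (@reindex (op A) unit_preord (brow j) unit_directed (brow_directed j)
    (ind_diag (@ind_const (op A) (D (s (upper_rank j))))) (ind_diag (sval (brow_pro X j)))
    (fun=> tt) (fun i => @idm (op A) (D (s (upper_rank j))))).
  - by move=> i; exact: iso_id.
  - by move=> i; exists (exist (fun i : int => (i <= j)%R) j (lexx j)); case: i.
  - by [].
  - move=> i i' h h'; apply: (@comp_heq (op A)); first by reflexivity.
    by symmetry; exact: (dmap1 D).
have [f hf] := dep_choice th.
have inv j : exists t : @hom (Proa A) (brow_pro X j) (pro_of (D (s (upper_rank j)))),
    t \oc (f j : @hom (Proa A) (pro_of (D (s (upper_rank j)))) (brow_pro X j)) =~ idm _ /\
    (f j : @hom (Proa A) (pro_of (D (s (upper_rank j)))) (brow_pro X j)) \oc t =~ idm _.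
  by have [[t [h1 h2]] _] := hf j; exists t; split; [exact: h2|exact: h1].
have [t ht] := dep_choice inv.
have nat_f j j' (h : (j <= j')%R) (h' : ple (s (upper_rank j)) (s (upper_rank j'))) :
    brow_map X h \oc (f j : @hom (Proa A) (pro_of (D (s (upper_rank j)))) (brow_pro X j)) =~
    (f j' : @hom (Proa A) (pro_of (D (s (upper_rank j')))) (brow_pro X j')) \oc
    pro_of_hom (dmap D h').
  move=> i; have [_ hj] := hf j; have [_ hj'] := hf j'.
  rewrite /= /germ_post /= hj hj'.
  exists tt, Logic.I, Logic.I => /=.
  by rewrite !compm1 comp1m; exact: dmap_irr.
have iso_sym (C : category) (a b : C) : isomorphic a b -> isomorphic b a.
  by move=> [g [g' [h1 h2]]]; exists g', g.
apply: iso_sym.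
pose DD : diagram (Proa A) I := ind_diag (indpro_of (exist _ (IndOb dI D) oD)).
have [F [iF _]] : exists F : @hom (Ind (Proa A)) (beilinson_of X) (IndOb dI DD),
    is_iso F /\ forall j : int_preord, icomp F j = @mkgerm (Proa A) (IndOb dI DD) _ (s (upper_rank j)) (t j).
  apply: (@reindex (Proa A) I int_preord dI int_directed
    DD (ind_diag (beilinson_of X)) (fun j => s (upper_rank j)) t).
  - move=> j; exists (f j); have [h1 h2] := ht j; split; [exact: h2|exact: h1].
  - by move=> i; have [n hn] := cof i; exists (Posz n).
  - by move=> j j' h; apply/smon/upper_rank_mono.
  - move=> j j' h h'; have [_ h2] := ht j; have [h1' _] := ht j'.
    apply: (inverse_natural h2 h1'); exact: nat_f.
by exists F.
Qed.

End Constant.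

(** * The Sato Grassmannian of the quotient *)

#[local] Opaque Proa.

Section Assembly.
Variables (A : exact_category) (hA : partially_abelian A).

(** Replaces the lattice U by an object of Pro^a(A) and its quotient by an object
    of Ind^a(A), to which both are only assumed to be isomorphic. *)
Lemma subobj_conf (U Y V B : Ind (Proa A)) (P : Proa A) (u : hom U Y) (v : hom V Y)
    (p : hom Y B) (a : hom U V) (b : hom V (ind_const P)) (B' : Inda A) (c : hom B (indpro_of B')) :
  ind_conf v p -> is_iso a -> v \oc a =~ u -> is_iso b -> is_iso c ->
  exists (k : hom (ind_const P) U), is_iso k /\
    zker (zeros_ind (zeros_pro A)) (u \oc k) (c \oc p).
Proof.
move=> hvp [a' [a1 a2]] eu [b' [b1 b2]] ic.
exists (a' \oc b'); split.
  by apply: iso_comp; [exists b | exists a].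
apply: zker_iso_seq (ind_conf_zker (pro_kc hA) hvp).
exists b, (idm Y), c; split; first by split; [exists b' | exact: iso_id |].
split; last by rewrite compm1; reflexivity.
rewrite comp1m -eu !compA -(compA v) a2 compm1 -compA b1 compm1; reflexivity.
Qed.

Lemma lattice_image_subobj (X Y Z U V B : Ind (Proa A)) (f : hom X Y) (g : hom Y Z)
    (u : hom U Y) (v : hom V Y) (p : hom Y B) (a : hom U V) (P : Proa A)
    (b : hom V (ind_const P)) (B' : Inda A) (c : hom B (indpro_of B')) :
  ind_conf f g -> ind_conf v p -> is_iso a -> v \oc a =~ u -> is_iso b -> is_iso c ->
  exists (W N : Proa A) (D : Inda A) (w0 : hom W P) (q0 : hom P N)
    (w : hom (ind_const W) U) (q : hom U (ind_const N))
    (x : hom (ind_const W) X) (m : hom (ind_const N) Z) (pm : hom Z (indpro_of D)),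
  [/\ is_pullback f u x w, f \oc x =~ u \oc w, g \oc u =~ m \oc q & conf w0 q0] /\
  iso_seq w q (ind_const_hom w0) (ind_const_hom q0) /\
  [/\ mono x, mono u, mono m & ind_conf m pm].
Proof.
move=> hfg hvp ia eu ib ic.
have [k [[k' [k1 k2]] zk]] := subobj_conf hvp ia eu ib ic.
have [W [N [D [w0 [q0 [x [m [pm [[cwq pb mx gu] hm]]]]]]]]] := lattice_image hA hfg zk.
have ik : is_iso k by exists k'.
exists W, N, D, w0, q0, (k \oc ind_const_hom w0), (ind_const_hom q0 \oc k'), x, m, pm.
have pb' : is_pullback f u x (k \oc ind_const_hom w0).
  by apply: pullback_iso ik _ pb; reflexivity.
split; first split.
- exact: pb'.
- by have [] := pb'.
- rewrite compA -gu -!compA k2 compm1; reflexivity.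
- exact: cwq.
split.
  exists (idm _), k', (idm _); split.
    by split; [exact: iso_id | exists k | exact: iso_id].
  by rewrite comp1m compm1 compA k1 comp1m; split; reflexivity.
split.
- exact: mx.
- have [_ mv _] := ind_conf_zker (pro_kc hA) hvp.
  by apply: mono_heq eu _; apply: mono_comp mv; exact: iso_mono.
- by have [] := ind_conf_zker (pro_kc hA) hm.
- exact: hm.
Qed.

Lemma pro_beilinson (P : Proa A) :
  exists o : inda_ob (ind_const P), @is_beilinson A (exist _ (ind_const P) o).
Proof.
have o : @inda_ob (Proa A) (ind_const P) by apply: ind_const_inda; exact: pro_id_adm.
by exists o; have [S h] := const_beilinson hA P; exists S.
Qed.

Lemma ind_beilinson (D : Inda A) :
  exists o : inda_ob (indpro_of D), @is_beilinson A (exist _ (indpro_of D) o).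
Proof.
have o : @inda_ob (Proa A) (indpro_of D).
  split; first exact: (svalP D).1.
  by move=> i j h; apply: pro_of_adm_mono => //; exact: (svalP D).2.
by exists o; have [S h] := indpro_beilinson hA D; exists S.
Qed.

End Assembly.

(** The conclusion concerns only arrows of the category E of ind-objects of
    Pro^a(A), so it passes to the full subcategories
    Ind^a(Pro^a(A)) and then to Beilinson objects; E and both subcategories are
    arbitrary here, [prE] and [inE] standing for being a pro-object or an
    ind-object, and [pcE] for conflations of pro-objects. *)
Section Generic.
Variables (E : category) (Pi : E -> Prop)
  (cf : forall a b c : E, hom a b -> hom b c -> Prop)
  (Pb : full_sub Pi -> Prop) (prE inE : E -> Prop)
  (pcE : forall a b c : E, hom a b -> hom b c -> Prop).

Let T : ccat := @cfull_sub
  (@CCat (full_sub Pi) (fun a b c i p => @cf (sval a) (sval b) (sval c) i p)) Pb.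
Local Notation ambient X := (sval (sval X)).

Definition in_full_sub (x : E) : Prop := exists o : Pi x, Pb (exist _ x o).

Definition sato_full_sub (X : T) (S : forall V : T, hom V X -> Prop) : Prop :=
  exists (V : T) (v : hom V X),
    [/\ adm_mono v, prE (ambient V),
        exists (Q : T) (p : hom X Q), conf v p /\ inE (ambient Q)
      & forall (V' : T) (v' : hom V' X), S V' v' <-> subobj v v'].

Hypothesis main : forall (X Y Z U V B : E) (f : hom X Y) (g : hom Y Z)
    (u : hom U Y) (v : hom V Y) (p : hom Y B) (a : hom U V),
  cf f g -> cf v p -> prE V -> inE B -> is_iso a -> v \oc a =~ u ->
  exists (W N D : E) (w : hom W U) (q : hom U N) (x : hom W X) (m : hom N Z) (pm : hom Z D),
  [/\ is_pullback f u x w, f \oc x =~ u \oc w, g \oc u =~ m \oc q & pcE w q] /\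
  [/\ mono x, mono u, mono m & cf m pm] /\
  [/\ in_full_sub W, in_full_sub N, in_full_sub D, prE N & inE D].

Lemma lattice_image_full_sub (X Y Z : T) (f : hom X Y) (g : hom Y Z) (hfg : conf f g)
  (U : T) (u : hom U Y) (hu : sato_full_sub (subobj u)) :
  exists (W Q : T) (w : hom W U) (q : hom U Q)
    (x : hom W X) (m : hom Q Z),
    [/\ is_pullback f u x w,
        f \oc x =~ u \oc w,
        g \oc u =~ m \oc q
      & @pcE (ambient W) (ambient U) (ambient Q) w q] /\
    [/\ mono x, mono u & mono m] /\
    adm_mono m /\ sato_full_sub (subobj m).
Proof.
have [V [v [_ hV [B [p [hvp hB]]] sub]]] := hu.
have [a [ia ea]] : subobj v u.
  by apply/sub; exists (idm U); split; [exact: iso_id | exact: compm1].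
have [W [N [D [w [q [x [m [pm]]]]]]]] :=
  @main (ambient X) (ambient Y) (ambient Z) (ambient U) (ambient V) (ambient B) f g u v p a hfg hvp hV hB ia ea.
move=> [[[c1 u1] c2 c3 c4] [[mx mu mm cm] [[oW bW] [oN bN] [oD bD] hN hD]]].
pose TW : T := exist _ (exist _ W oW) bW.
pose TN : T := exist _ (exist _ N oN) bN.
pose TD : T := exist _ (exist _ D oD) bD.
exists TW, TN, w, q, x, m.
have am : @adm_mono T TN Z m by exists TD, pm.
split; first split.
- by split; [exact: c1 | move=> t; exact: u1].
- exact: c2.
- exact: c3.
- exact: c4.
split; first by split; move=> t; [exact: mx | exact: mu | exact: mm].
split; first exact: am.
exists TN, m; split=> //.
by exists TD, pm.
Qed.

End Generic.

Theorem theorem3p42 (A : exact_category) (hA : partially_abelian A)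
  (X Y Z : Beilinson A) (f : hom X Y) (g : hom Y Z) (hfg : conf f g)
  (U : Beilinson A) (u : hom U Y) (hu : Sato (subobj u)) :
  exists (W Q : Beilinson A) (w : hom W U) (q : hom U Q)
    (x : hom W X) (m : hom Q Z),
    [/\ is_pullback f u x w,
        f \oc x =~ u \oc w,
        g \oc u =~ m \oc q
      & pro_conf w q] /\
    [/\ mono x, mono u & mono m] /\
    adm_mono m /\ Sato (subobj m).
Proof.
apply: (@lattice_image_full_sub (Ind (Proa A)) (@inda_ob (Proa A)) (@ind_conf (Proa A))
  (@is_beilinson A)
  (fun x => exists P : Proa A, isomorphic x (ind_const P))
  (fun x => exists D : Inda A, isomorphic x (indpro_of D))
  (fun R S T i p => exists (P Q N : Proa A) (i' : hom P Q) (p' : hom Q N),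
    conf i' p' /\ iso_seq i p (ind_const_hom i') (ind_const_hom p'))
  _ X Y Z f g hfg U u hu).
move=> {}X {}Y {}Z {hfg hu} {}U V B {}f {}g {}u v p a hfg hvp [P [b ib]] [B' [c ic]] ia ea.
have [W [N [D [w0 [q0 [w [q [x [m [pm]]]]]]]]]] := lattice_image_subobj hA hfg hvp ia ea ib ic.
move=> [[h1 h2 h3 h4] [h5 [h6 h7 h8 h9]]].
exists (ind_const W), (ind_const N), (indpro_of D), w, q, x, m, pm.
split; first by split; [exact: h1 | exact: h2 | exact: h3 | exists W, P, N, w0, q0].
split; first by split; [exact: h6 | exact: h7 | exact: h8 | exact: h9].
split; [exact: pro_beilinson | exact: pro_beilinson | exact: ind_beilinson | |].
  by exists N, (idm _); exact: iso_id.
by exists D, (idm _); exact: iso_id.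
Qed.
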